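(* Let $\mathcal S$, $N$, $\mathcal T$, $\mathcal K$, $M_0$, $K$, $f$, $g$, $c_{xy}$, $J_M$ be as in the context. Assume: (1) for every $x\in\mathcal S$ the functions $g(x,\cdot)$ on $\mathcal P(\mathcal S)$ and $(p,M)\mapsto\sum_{y\in\mathcal S}p(y)c_{xy}(p,M)$ on $\mathcal P(\mathcal S)\times\mathcal P(\mathcal S)$ are continuous; (2) for every $U:\mathcal S\to\mathbb R$, $M\in\mathcal P(\mathcal S)$ and $x\in\mathcal S$, the problem $\inf_{p\in\mathcal P(\mathcal S)}\sum_{y\in\mathcal S}p(y)\left[c_{xy}(p,M)+U(y)\right]$ admits a unique solution; (3) $f$ and $g$ are monotone: for $h=f$ and $h=g$, $\sum_{x\in\mathcal S}\left(h(x,M)-h(x,M')\right)\left(M(x)-M'(x)\right)\ge 0$ for all $M,M'\in\mathcal P(\mathcal S)$; (4) $f$ and $g$ are Lipschitz with respect to their second argument. Let $(P_n,M_n,\bar M_n)$ be the sequence generated by the fictitious play procedure: $M_1:\mathcal T\to\mathcal P(\mathcal S)$ is arbitrary, $\bar M_1=M_1$, and for $n\ge1$ $$P_n:=\mathrm{argmin}_{P\in\mathcal K}J_{\bar M_n}(P),\qquad M_{n+1}(\cdot,k):=M_{P_n}^{M_0}(\cdot,k),\qquad \bar M_{n+1}(\cdot,k):=\tfrac{n}{n+1}\bar M_n(\cdot,k)+\tfrac1{n+1}M_{n+1}(\cdot,k),\quad k=0,\dots,N.$$ Then $$(P_n,M_n,\bar M_n)\to(\hat P,M_{\hat P}^{M_0},M_{\hat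 P}^{M_0}),$$ where $\hat P$ is the unique solution of the finite mean field game problem: find $\hat P\in\mathcal K$ such that $\hat P\in\mathrm{argmin}_{P\in\mathcal K}J_M(P)$ with $M=M_{\hat P}^{M_0}$.
   Context: $\mathcal S$ is a finite set, $\mathcal T=\{0,\dots,N\}$, and $\mathcal P(\mathcal S)=\{m:\mathcal S\to[0,1] : \sum_{x\in\mathcal S} m(x)=1\}$ is the simplex in $\mathbb R^{|\mathcal S|}$, identified with the set of probability measures on $\mathcal S$. $\mathcal K$ is the set of transition kernels, i.e. maps $P:\mathcal S\times\mathcal S\times(\mathcal T\setminus\{N\})\to[0,1]$ with $P(x,\cdot,k)\in\mathcal P(\mathcal S)$ for all $x\in\mathcal S$ and $k\in\mathcal T\setminus\{N\}$; it is seen as a compact subset of $\mathbb R^{|\mathcal S|\times|\mathcal S|\times N}$. $M_0\in\mathcal P(\mathcal S)$ is a given initial distribution. For $P\in\mathcal K$, $M_P^{M_0}:\mathcal T\to\mathcal P(\mathcal S)$ is defined by $M_P^{M_0}(x,0)=M_0(x)$ and $M_P^{M_0}(x,k)=\sum_{y\in\mathcal S}M_P^{M_0}(y,k-1)P(y,x,k-1)$ for $k=1,\dots,N$, $x\in\mathcal S$. A map $M:\mathcal T\to\mathcal P(\mathcal S)$ is also written $M(x,k)=M(k)(x)$. The running cost has the separable form $c_{xy}(p,M)=K(x,y,p)+f(x,M)$ for $x,y\in\mathcal S$, $p,M\in\mathcal P(\mathcal S)$, where $K:\mathcal S\times\mathcal S\times\mathcal P(\mathcal S)\to\mathbb R$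 and $f:\mathcal S\times\mathcal P(\mathcal S)\to\mathbb R$ are given; the terminal cost is $g:\mathcal S\times\mathcal P(\mathcal S)\to\mathbb R$. For $M:\mathcal T\to\mathcal P(\mathcal S)$ and $P\in\mathcal K$, $$J_M(P)=\sum_{k=0}^{N-1}\sum_{x,y\in\mathcal S}M_P^{M_0}(x,k)P(x,y,k)c_{xy}(P(x,\cdot,k),M(k))+\sum_{x\in\mathcal S}M_P^{M_0}(x,N)g(x,M(N)).$$ It is asserted, as a consequence of the dynamic programming principle, that under (2) the problem $\inf_{P\in\mathcal K}J_M(P)$ admits a unique solution for every $M:\mathcal T\to\mathcal P(\mathcal S)$, so that the sequences $(P_n)$ and $(M_n)$ are well defined under (1)–(2); $P_n$ denotes the minimizer of $J_{\bar M_n}$ over $\mathcal K$.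
   Formalization: Uniqueness of P̂ and convergence of P_n at all states are proved assuming inf J_M has a unique minimizer for every M, which (2) does not imply at unvisited states; without it, they hold at states with positive equilibrium mass, and M_n, M̄_n still converge. *)

(* Defs.v *)
From HB Require Import structures.
From mathcomp Require Import all_boot all_order all_algebra.
From mathcomp Require Import all_classical all_reals all_analysis.
Set Implicit Arguments.
Unset Strict Implicit.
Unset Printing Implicit Defensive.
Import Order.TTheory GRing.Theory Num.Theory.
Import numFieldNormedType.Exports.
Local Open Scope classical_set_scope.
Local Open Scope ring_scope.

(* Times 0, ..., N are 'I_N.+1 and times 0, ..., N-1 are 'I_N. *)
Definition time0 (N : nat) : 'I_N.+1 := ord0.
Definition timeN (N : nat) : 'I_N.+1 := ord_max.
Definition now (N : nat) (k : 'I_N) : 'I_N.+1 := widen_ord (leqnSn N) k.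
Definition next (N : nat) (k : 'I_N) : 'I_N.+1 := lift ord0 k.

(* Functions of a probability measure are total functions on S -> R; they are
   only ever evaluated, and hypotheses on them only bear, on [simplex]. *)
Definition simplex (R : realType) (S : finType) : set (S -> R) :=
  [set m | (forall x, 0 <= m x <= 1) /\ \sum_x m x = 1].

Definition kernels (R : realType) (S : finType) (N : nat) :
    set (S -> S -> 'I_N -> R) :=
  [set P | forall x k, simplex (fun y => P x y k)].

Definition simplex_paths (R : realType) (S : finType) (N : nat) :
    set ('I_N.+1 -> S -> R) :=
  [set M | forall k, simplex (M k)].

Definition is_argmin (R : realType) (T : Type) (A : set T) (F : T -> R) (p : T)
    : Prop :=
  A p /\ forall q, A q -> F p <= F q.

(* [flow M0 P k x] is M_P^{M0}(x,k).  The recursion runs over nat; the [None]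
   branch is only met at times beyond N. *)
Fixpoint flow_rec (R : realType) (S : finType) (N : nat) (M0 : S -> R)
    (P : S -> S -> 'I_N -> R) (k : nat) : S -> R :=
  match k with
  | 0%N => M0
  | k'.+1 => fun x =>
      match insub k' : option 'I_N with
      | Some i => \sum_y flow_rec M0 P k' y * P y x i
      | None => 0
      end
  end.

Definition flow (R : realType) (S : finType) (N : nat) (M0 : S -> R)
    (P : S -> S -> 'I_N -> R) : 'I_N.+1 -> S -> R :=
  fun k => flow_rec M0 P k.

Lemma flow0 (R : realType) (S : finType) (N : nat) (M0 : S -> R)
    (P : S -> S -> 'I_N -> R) : flow M0 P (time0 N) = M0.
Proof. by []. Qed.

Lemma flowS (R : realType) (S : finType) (N : nat) (M0 : S -> R)
    (P : S -> S -> 'I_N -> R) (k : 'I_N) (x : S) :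
  flow M0 P (next k) x = \sum_y flow M0 P (now k) y * P y x k.
Proof.
rewrite /flow /=; case: insubP => [i _ ik|]; last first.
  by rewrite ltn_ord.
by rewrite (val_inj ik : i = k).
Qed.

Definition cost (R : realType) (S : finType) (K : S -> S -> (S -> R) -> R)
    (f : S -> (S -> R) -> R) (x y : S) (p M : S -> R) : R :=
  K x y p + f x M.

Definition J (R : realType) (S : finType) (N : nat) (M0 : S -> R)
    (K : S -> S -> (S -> R) -> R) (f g : S -> (S -> R) -> R)
    (M : 'I_N.+1 -> S -> R) (P : S -> S -> 'I_N -> R) : R :=
  \sum_(k < N) \sum_x \sum_y
     flow M0 P (now k) x * P x y k
       * cost K f x y (fun z => P x z k) (M (now k))
  + \sum_x flow M0 P (timeN N) x * g x (M (timeN N)).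

(* {ptws S -> R} is S -> R with the product topology, i.e. R^|S| as S is
   finite. *)
Definition costs_continuous (R : realType) (S : finType)
    (K : S -> S -> (S -> R) -> R) (f g : S -> (S -> R) -> R) : Prop :=
  forall x : S,
    {within (@simplex R S : set {ptws S -> R}),
       continuous (g x : {ptws S -> R} -> R)} /\
    {within ((@simplex R S : set {ptws S -> R})
               `*` (@simplex R S : set {ptws S -> R})),
       continuous (fun pM : {ptws S -> R} * {ptws S -> R} =>
         \sum_y pM.1 y * cost K f x y pM.1 pM.2)}.

Definition unique_one_step_minimizers (R : realType) (S : finType)
    (K : S -> S -> (S -> R) -> R) (f : S -> (S -> R) -> R) : Prop :=
  forall (U M : S -> R) (x : S), simplex M ->
    exists! p : S -> R,
      is_argmin (@simplex R S)
        (fun q => \sum_y q y * (cost K f x y q M + U y)) p.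

Definition monotone_cost (R : realType) (S : finType)
    (h : S -> (S -> R) -> R) : Prop :=
  forall M M' : S -> R, simplex M -> simplex M' ->
    0 <= \sum_x (h x M - h x M') * (M x - M' x).

(* The l1 norm on R^|S| is used; all norms are equivalent. *)
Definition lipschitz_cost (R : realType) (S : finType)
    (h : S -> (S -> R) -> R) : Prop :=
  exists L : R, forall (x : S) (M M' : S -> R), simplex M -> simplex M' ->
    `|h x M - h x M'| <= L * \sum_y `|M y - M' y|.

(* Sequences start at index 1; their values at index 0 are irrelevant. *)
Definition fictitious_play (R : realType) (S : finType) (N : nat)
    (M0 : S -> R) (K : S -> S -> (S -> R) -> R) (f g : S -> (S -> R) -> R)
    (P : nat -> S -> S -> 'I_N -> R) (M Mbar : nat -> 'I_N.+1 -> S -> R)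
    : Prop :=
  [/\ simplex_paths (M 1%N),
      Mbar 1%N = M 1%N &
      forall n : nat, (1 <= n)%N ->
        [/\ is_argmin (@kernels R S N) (J M0 K f g (Mbar n)) (P n),
            M n.+1 = flow M0 (P n) &
            forall k x, Mbar n.+1 k x =
              n%:R / n.+1%:R * Mbar n k x + 1 / n.+1%:R * M n.+1 k x]].

Definition mfg_solution (R : realType) (S : finType) (N : nat)
    (M0 : S -> R) (K : S -> S -> (S -> R) -> R) (f g : S -> (S -> R) -> R)
    (P : S -> S -> 'I_N -> R) : Prop :=
  is_argmin (@kernels R S N) (J M0 K f g (flow M0 P)) P.

(* For |S| > 1 this does not follow from [unique_one_step_minimizers]: if
   flow M0 P (now k) x = 0 then P x y k does not enter J. *)
Definition unique_minimizers (R : realType) (S : finType) (N : nat)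
    (M0 : S -> R) (K : S -> S -> (S -> R) -> R) (f g : S -> (S -> R) -> R)
    : Prop :=
  forall M : 'I_N.+1 -> S -> R, simplex_paths M ->
    exists! P : S -> S -> 'I_N -> R,
      is_argmin (@kernels R S N) (J M0 K f g M) P.

Definition paths_cvg (R : realType) (S : finType) (N : nat)
    (M : nat -> 'I_N.+1 -> S -> R) (L : 'I_N.+1 -> S -> R) : Prop :=
  forall k x, M n k x @[n --> \oo] --> L k x.

(* Main.v *)
Require Import Defs.
From HB Require Import structures.
From mathcomp Require Import all_boot all_order all_algebra.
From mathcomp Require Import all_classical all_reals all_analysis.
From mathcomp Require Import ring lra.
Import Order.TTheory GRing.Theory Num.Theory.
Import numFieldNormedType.Exports.
Local Open Scope classical_set_scope.
Local Open Scope ring_scope.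

Set Implicit Arguments.
Unset Strict Implicit.
Unset Printing Implicit Defensive.

(* Not the successor in a cyclic sequence, which has the same name. *)
Local Notation next := Defs.next.

(** Write m for flows, c(M) for the vector of mean field costs f(x, M(k)) and
    g(x, M(N)), and <.,.> for the sum over times and states.  The cost of a
    kernel P is J_M(P) = A(P) + <c(M), flow P>, where A(P) collects the costs K
    and is the same for all M.  Everything rests on one quantitative form of
    uniqueness ([policy_stability], [response_stability]): for every e > 0 there
    is C such that, for all paths M, all kernels Q and all minimizers P of J_M,
      dist (flow Q) (flow P) <= e + C (J_M(Q) - J_M(P)).
    For a single transition this follows from the uniqueness of the minimizer
    by compactness ([one_step_stability]).  Dynamic programming carries it over
    to flows: the excess cost of Q is the sum, weighted by the flow of Q, of the
    excess costs of its single transitions ([performance_difference]).  The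
    bound is affine in the excess cost, so it can be averaged over many
    kernels Q.

    As A cancels, exchanging the path and the kernel gives ([J_cross])
      J_M(P) - J_M'(P) - J_M(Q) + J_M'(Q) = <c(M) - c(M'), flow P - flow Q>,
    which is bilinear, nonnegative if M = flow P and M' = flow Q (monotonicity),
    and at most L dist(M, M') dist(flow P, flow Q) in absolute value.

    In fictitious play let B_n be the averaged path, P_n a best response to it
    and m_n its flow.  The excess of the past responses against B_n,
      E_n = sum_(i < n) (J_(B_n)(P_i) - J_(B_n)(P_n)),
    grows in each step by at most a quantity that tends to 0: m_n - B_(n+1) is
    a positive multiple of B_(n+1) - B_n, hence monotonicity makes the main term
    nonpositive, and the rest is bounded by dist(m_n, m_(n+1)) and
    dist(B_n, B_(n+1)), which tend to 0.  So E_n / n tends to 0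
    ([excess_average_vanish]).  As B_n is the average of the past flows up to
    O(1/n), stability gives dist(m_n, B_n) -> 0 ([flow_belief_vanish]).

    Now the exchange identity for B_p and B_q, with m_p and m_q close to B_p and
    B_q, shows that the excess of P_q against B_p is small, so (m_n) is a Cauchy
    sequence ([flow_cauchy]).  Its limit is the flow of the dynamic programming
    policy against it, which is therefore an equilibrium; existence is thus a
    consequence of the convergence of the procedure.  Equilibria are best
    responses to each other's flows by monotonicity ([equilibrium_response]),
    whence uniqueness.  Kernels converge where the limit flow is positive
    because there stability also controls them; if best responses are unique
    everywhere, P_n is the policy against B_n, which depends continuously on
    B_n. *)

(** * The simplex with the l1 distance *)

Definition pairing (R : realType) (S : finType) (q U : S -> R) : R :=
  \sum_y q y * U y.

Definition l1 (R : realType) (S : finType) (p q : S -> R) : R :=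
  \sum_y `|p y - q y|.

Section Distance.
Variables (R : realType) (S : finType).
Implicit Types p q r U V : S -> R.

Lemma l1_ge0 p q : 0 <= l1 p q.
Proof. by apply: sumr_ge0 => y _. Qed.

Lemma l1C p q : l1 p q = l1 q p.
Proof. by apply: eq_bigr => y _; rewrite distrC. Qed.

Lemma l1_triangle r p q : l1 p q <= l1 p r + l1 r q.
Proof. by rewrite -big_split /=; apply: ler_sum => y _; exact: ler_distD. Qed.

Lemma l1_coord p q y : `|p y - q y| <= l1 p q.
Proof.
rewrite /l1 (bigD1 y) //= lerDl; apply: sumr_ge0 => z _; exact: normr_ge0.
Qed.

Lemma l1_eq0 p q : l1 p q <= 0 -> p = q.
Proof.
move=> h; apply/funext => y; apply/eqP; rewrite -subr_eq0 -normr_le0.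
exact: le_trans (l1_coord p q y) h.
Qed.

Lemma simplex_l1 p q : simplex p -> simplex q -> l1 p q <= 2.
Proof.
move=> [p01 p1] [q01 q1].
have -> : 2 = \sum_y (p y + q y) :> R by rewrite big_split /= p1 q1.
apply: ler_sum => y _; have /andP[p0 _] := p01 y; have /andP[q0 _] := q01 y.
by apply: le_trans (ler_normB _ _) _; rewrite !ger0_norm.
Qed.

Lemma simplexE p : (forall y, 0 <= p y) -> \sum_y p y = 1 -> simplex p.
Proof.
move=> p0 p1; split=> // x; rewrite p0 /= -p1 (bigD1 x) //= lerDl.
by apply: sumr_ge0.
Qed.

Lemma simplex_ge0 p y : simplex p -> 0 <= p y.
Proof. by case=> /(_ y)/andP[]. Qed.

Lemma pairing_bound q U B : simplex q -> (forall y, `|U y| <= B) ->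
  `|pairing q U| <= B.
Proof.
move=> [q01 q1] UB; apply: le_trans (ler_norm_sum _ _ _) _.
rewrite -[leRHS]mul1r -q1 mulr_suml; apply: ler_sum => y _.
by have /andP[q0 _] := q01 y; rewrite normrM (ger0_norm q0) ler_wpM2l.
Qed.

Lemma pairingB q U V :
  pairing q U - pairing q V = pairing q (fun y => U y - V y).
Proof. by rewrite -sumrB; apply: eq_bigr => y _; rewrite mulrBr. Qed.

End Distance.

(** * Compactness of the simplex *)

Section Compactness.

Lemma cvg_triple1 (X Y Z : topologicalType) (t : X * Y * Z) :
  (fun s => s.1.1) @ t --> t.1.1.
Proof.
apply: (@cvg_comp _ _ _ (fun s : X * Y * Z => s.1) (fun s => s.1) _ (nbhs t.1));
  exact: cvg_fst.
Qed.

Lemma cvg_triple2 (X Y Z : topologicalType) (t : X * Y * Z) :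
  (fun s => s.1.2) @ t --> t.1.2.
Proof.
apply: (@cvg_comp _ _ _ (fun s : X * Y * Z => s.1) (fun s => s.2) _ (nbhs t.1)).
  exact: cvg_fst.
exact: cvg_snd.
Qed.

Variables (R : realType) (S : finType).
Notation V := {ptws S -> R}.

Lemma coord_continuous (y : S) : continuous (fun m : V => m y).
Proof. exact: (@proj_continuous S (fun=> R) y). Qed.

Lemma coord_cvg (T : Type) (F : set_system T) (h : T -> V) (m : V) (y : S) :
  Filter F -> h @ F --> m -> h t y @[t --> F] --> m y.
Proof.
move=> FF hm; apply: (@continuous_cvg T V R F FF h (fun m : V => m y)) => //.
exact: coord_continuous.
Qed.

Lemma sum_cvg (T : Type) (F : set_system T) (h : S -> T -> R) (l : S -> R) :
  Filter F -> (forall y, h y t @[t --> F] --> l y) ->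
  \sum_y h y t @[t --> F] --> \sum_y l y.
Proof. by move=> FF hl; apply: cvg_big => // -[u v]; exact: add_continuous. Qed.

Lemma closed_sublevel (T : topologicalType) (h : T -> R) (c : R) :
  continuous h -> closed [set t | h t <= c].
Proof.
move=> hc; apply: (@preimage_closed _ _ h [set x | x <= c]);
  last exact: closed_le.
by move=> t _; exact: hc.
Qed.

Lemma closed_superlevel (T : topologicalType) (h : T -> R) (c : R) :
  continuous h -> closed [set t | c <= h t].
Proof.
move=> hc; apply: (@preimage_closed _ _ h [set x | c <= x]);
  last exact: closed_ge.
by move=> t _; exact: hc.
Qed.

Lemma box_compact (B : R) :
  compact ([set U | forall y, `|U y| <= B] : set V).
Proof.
have := @tychonoff S (fun=> R) (fun=> `[- B, B]%classic)
  (fun=> @segment_compact R (- B) B).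
congr (compact _); apply/seteqP; split => U /= h y;
  by have := h y; rewrite ?in_itv /= ler_norml.
Qed.

Lemma simplex_closed : closed (@simplex R S : set V).
Proof.
have sumc : continuous (fun m : V => \sum_y m y).
  move=> m; apply: (@sum_cvg V (nbhs m) (fun y (t : V) => t y) m) => y.
  exact: coord_continuous.
have -> : (@simplex R S : set V) =
    \bigcap_(y in setT) [set m : V | 0 <= m y] `&`
    ([set m : V | \sum_y m y <= 1] `&` [set m : V | 1 <= \sum_y m y]).
  apply/seteqP; split => [m [m01 m1]|m [m0 [/= ma mb]]] /=.
    by split => [y _|] /=; rewrite ?m1 //; have /andP[] := m01 y.
  by apply: simplexE => [y|]; [exact: m0 | apply/eqP; rewrite eq_le ma mb].
apply: closedI; [apply: closed_bigI => y _|apply: closedI].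
- by apply: closed_superlevel; exact: coord_continuous.
- exact: closed_sublevel.
- exact: closed_superlevel.
Qed.

Lemma simplex_compact : compact (@simplex R S : set V).
Proof.
apply: (subclosed_compact (@simplex_closed) (@box_compact 1)) => p [p01 _] y.
by have /andP[p0 p1] := p01 y; rewrite ger0_norm.
Qed.

End Compactness.

(** * Stability of the one-step minimizers *)

(** With [phi] the expected running cost of a distribution [q] over the next
    state and [U] the cost to go, [score phi U q] is the expected total cost of
    choosing [q]. *)
Definition score (R : realType) (S : finType) (phi : (S -> R) -> R)
  (U q : S -> R) : R := phi q + pairing q U.

Definition best (R : realType) (S : finType) (phi : (S -> R) -> R)
    (U : S -> R) : S -> R :=
  xget (fun=> 0) [set p | is_argmin (@simplex R S) (score phi U) p].

Definition gap (R : realType) (S : finType) (phi : (S -> R) -> R)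
  (U q : S -> R) : R := score phi U q - score phi U (best phi U).

Section OneStep.
Variables (R : realType) (S : finType) (phi : (S -> R) -> R).
Notation V := {ptws S -> R}.
Notation simp := (@simplex R S).
Hypothesis phi_cont : {within (simp : set V), continuous (phi : V -> R)}.
Hypothesis phi_min : forall U, exists! p, is_argmin simp (score phi U) p.

Lemma best_argmin U : is_argmin simp (score phi U) (best phi U).
Proof.
have [p [hp _]] := phi_min U.
by rewrite /best; case: xgetP => [q _ //|/(_ p)].
Qed.

Lemma best_unique U p : is_argmin simp (score phi U) p -> p = best phi U.
Proof.
have [q [_ qu]] := phi_min U => hp.
by rewrite -(qu _ hp) -(qu _ (best_argmin U)).
Qed.

Lemma best_simplex U : simp (best phi U).
Proof. by have [] := best_argmin U. Qed.

Lemma gap_ge0 U q : simp q -> 0 <= gap phi U q.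
Proof. by move=> sq; rewrite subr_ge0; have [_] := best_argmin U; apply. Qed.

Lemma gap_best U : gap phi U (best phi U) = 0.
Proof. exact: subrr. Qed.

Lemma gap_eq0 U q : simp q -> gap phi U q <= 0 -> q = best phi U.
Proof.
move=> sq; rewrite subr_le0 => h; apply: best_unique; split=> // r sr.
by apply: le_trans h _; have [_] := best_argmin U; apply.
Qed.

(** The term [phi q] cancels, and [q] averages the difference of the costs to
    go. *)
Lemma score_diff U U' q e : simp q -> (forall y, `|U y - U' y| <= e) ->
  `|score phi U q - score phi U' q| <= e.
Proof.
move=> sq h; rewrite /score opprD addrACA subrr add0r pairingB.
exact: pairing_bound.
Qed.

Lemma value_lipschitz U U' e : (forall y, `|U y - U' y| <= e) ->
  `|score phi U (best phi U) - score phi U' (best phi U')| <= e.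
Proof.
move=> h; have [s m] := best_argmin U; have [s' m'] := best_argmin U'.
have := score_diff s h; have := score_diff s' h; rewrite !ler_norml.
by have := m _ s'; have := m' _ s; lra.
Qed.

Lemma gap_best_lipschitz U U' e : (forall y, `|U y - U' y| <= e) ->
  gap phi U (best phi U') <= 2 * e.
Proof.
move=> h; have [s m] := best_argmin U; have [s' m'] := best_argmin U'.
have := score_diff s h; have := score_diff s' h; rewrite /gap !ler_norml.
by have := m' _ s; lra.
Qed.

Lemma phi_bounded : exists B, forall p, simp p -> `|phi p| <= B.
Proof.
have /ex_strict_bound_gt0[B _ hB] : bounded_set (phi @` simp).
  by apply: compact_bounded; apply: (continuous_compact phi_cont);
    exact: simplex_compact.
by exists B => p sp; apply/ltW/hB; exists p.
Qed.

Lemma value_bounded : exists B, forall U b, (forall y, `|U y| <= b) ->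
  `|score phi U (best phi U)| <= B + b.
Proof.
have [B hB] := phi_bounded; exists B => U b Ub.
apply: le_trans (ler_normD _ _) _; apply: lerD; first exact/hB/best_simplex.
exact: pairing_bound (best_simplex U) Ub.
Qed.

(** Brings continuity within the simplex to bear along an arbitrary filter. *)
Lemma cvg_within_set (T : Type) (F : set_system T) (W : topologicalType)
    (D : set W) (h : T -> W) (m : W) : Filter F ->
  h @ F --> m -> (\forall t \near F, D (h t)) -> h @ F --> within D (nbhs m).
Proof.
move=> FF hm hD A /= DA; have := hm _ DA; rewrite /= !nbhs_simpl /= => h1.
by apply: filterS2 h1 hD => t /= DhA hDt; exact: DhA.
Qed.

Lemma pairing_cvg (T : Type) (F : set_system T) (h h' : T -> V) (m m' : V) :
  Filter F -> h @ F --> m -> h' @ F --> m' ->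
  pairing (h t) (h' t) @[t --> F] --> pairing m m'.
Proof.
move=> FF hm hm'.
apply: (@sum_cvg R S T F (fun y t => h t y * h' t y) (fun y => m y * m' y)).
by move=> y; apply: cvgM; exact: coord_cvg.
Qed.

Lemma l1_cvg (T : Type) (F : set_system T) (h h' : T -> V) (m m' : V) :
  Filter F -> h @ F --> m -> h' @ F --> m' ->
  l1 (h t) (h' t) @[t --> F] --> l1 m m'.
Proof.
move=> FF hm hm'.
apply: (@sum_cvg R S T F (fun y t => `|h t y - h' t y|)
  (fun y => `|m y - m' y|)) => y.
by apply: cvg_norm; apply: cvgB; exact: coord_cvg.
Qed.

(** The minimal score is 1-Lipschitz for the sup norm, hence for [l1]. *)
Lemma value_continuous :
  continuous (fun U : V => score phi U (best phi U)).
Proof.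
set v : V -> R := fun U => _; move=> U.
apply/(@cvgrPdist_le R R^o V (nbhs U) (nbhs_filter U) v (v U)) => e e0.
have : l1 U U' @[U' --> nbhs (U : V)] --> l1 U U.
  apply: (@l1_cvg V (nbhs U) (fun=> U) id U U); last exact: cvg_id.
  exact: (@cvg_cst V U V (nbhs U)).
move=> /(@cvgrPdist_le R R^o V (nbhs U) (nbhs_filter U) (fun U' => l1 U U')
  (l1 U U))/(_ e e0).
apply: filterS => U' /= hU'; apply: (@value_lipschitz U U' e) => y.
apply: le_trans (l1_coord U U' y) _; apply: le_trans _ hU'.
have -> : l1 U U = 0 by rewrite /l1 big1 // => z _; rewrite subrr normr0.
by rewrite sub0r normrN ger0_norm // l1_ge0.
Qed.

Lemma score_cvg (T : Type) (F : set_system T) (h h' : T -> V) (m m' : V) :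
  Filter F -> h @ F --> m -> h' @ F --> m' ->
  (\forall t \near F, simp (h' t)) -> simp m' ->
  score phi (h t) (h' t) @[t --> F] --> score phi m m'.
Proof.
move=> FF hm hm' hs sm'; apply: cvgD; last exact: pairing_cvg.
have /subspace_continuousP/(_ _ sm') := phi_cont.
by apply: cvg_comp; exact: cvg_within_set.
Qed.

(** The sum of the gaps of [p] and [q] at [U] is a continuous function of
    [(U, p, q)].  On the compact set of the triples with [l1 p q >= e] it is
    positive, since a zero would give two distinct minimizers; let [c] minimize
    it.  With [p] the minimizer at [U], a [q] at distance at least [e] from it
    has a gap that is at least this minimum, while [l1] never exceeds 2.  This
    makes the constant uniform in [U] without prior continuity of [best]. *)
Lemma one_step_stability B e : 0 < e ->
  exists C, 0 <= C /\ forall U q, (forall y, `|U y| <= B) -> simp q ->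
    l1 q (best phi U) <= e + C * gap phi U q.
Proof.
move=> e0.
pose box : set V := [set U | forall y, `|U y| <= B].
pose far := (box `*` (simp : set V) `*` (simp : set V)) `&`
  [set t | e <= l1 t.1.2 t.2].
pose G (t : V * V * V) := score phi t.1.1 t.1.2 + score phi t.1.1 t.2 -
  2 * score phi t.1.1 (best phi t.1.1).
have c1 (t : V * V * V) : (fun s : V * V * V => s.1.1) @ t --> t.1.1.
  exact: cvg_triple1.
have c2 (t : V * V * V) : (fun s : V * V * V => s.1.2) @ t --> t.1.2.
  exact: cvg_triple2.
have c3 (t : V * V * V) : (fun s : V * V * V => s.2) @ t --> t.2.
  exact: cvg_snd.
have far_compact : compact far.
  apply: compact_closedI.
    apply: compact_setX; last exact: simplex_compact.
    by apply: compact_setX; [exact: box_compact | exact: simplex_compact].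
  apply: (@closed_superlevel R (V * V * V)%type (fun t => l1 t.1.2 t.2)) => t.
  exact: (l1_cvg _ (c2 t) (c3 t)).
have G_cont : {within far, continuous G}.
  apply/subspace_continuousP => t farT; have [[[tb tp] tq] te] := farT.
  have lim (h : V * V * V -> V) : h @ t --> h t ->
      h @ within far (nbhs t) --> h t.
    by move=> ht; apply: cvg_trans ht; apply: cvg_app; exact: cvg_within.
  have inside (h : V * V * V -> V) : (forall s, far s -> simp (h s)) ->
      \forall s \near within far (nbhs t), simp (h s).
    by move=> hs; near=> s; apply: hs; near: s; exact: withinT.
  apply: cvgB; first apply: cvgD.
  - apply: (score_cvg _ (lim (fun s => s.1.1) (c1 t))
      (lim (fun s => s.1.2) (c2 t)) _ tp).
    by apply: inside => s [[[]]].
  - apply: (score_cvg _ (lim (fun s => s.1.1) (c1 t))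
      (lim (fun s => s.2) (c3 t)) _ tq).
    by apply: inside => s [[[]]].
  - apply: cvgM; first exact: cvg_cst.
    exact: (@cvg_comp _ _ _ (fun s : V * V * V => s.1.1)
      (fun U : V => score phi U (best phi U)) (within far (nbhs t))
      (nbhs (t.1.1 : V)) _ (lim (fun s => s.1.1) (c1 t))
      (@value_continuous t.1.1)).
have l1_self U : l1 U U = 0.
  by rewrite /l1 big1 // => y _; rewrite subrr normr0.
have [far0|far_neq0] := eqVneq far set0.
  exists 0; split=> // U q UB sq; rewrite mul0r addr0 leNgt; apply/negP => lt.
  suff : far (U, q, best phi U) by rewrite far0.
  by split; [split; [split|exact: best_simplex]|exact: ltW].
have /set0P far_ex := far_neq0.
have [c /set_mem cfar cmin] := compact_EVT_min far_ex far_compact G_cont.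
have [[[cb cp] cq] ce] := cfar.
have GE t : G t = gap phi t.1.1 t.1.2 + gap phi t.1.1 t.2.
  by rewrite /G /gap; ring.
have Gc : 0 < G c.
  rewrite ltNge; apply/negP => Gle0.
  have g1 := gap_ge0 c.1.1 cp; have g2 := gap_ge0 c.1.1 cq.
  have e1 : c.1.2 = best phi c.1.1.
    by apply: gap_eq0 => //; move: Gle0; rewrite GE; lra.
  have e2 : c.2 = best phi c.1.1.
    by apply: gap_eq0 => //; move: Gle0; rewrite GE; lra.
  by move: ce => /=; rewrite e1 e2 l1_self leNgt e0.
exists (2 / G c); split; first by rewrite divr_ge0 // ltW.
move=> U q UB sq; have gq := gap_ge0 U sq.
have [lt|ge] := ltP (l1 q (best phi U)) e.
  by rewrite (le_trans (ltW lt)) // lerDl mulr_ge0 // divr_ge0 // ltW.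
have : G c <= G (U, q, best phi U).
  apply: cmin; apply/mem_set.
  by split; [split; [split|exact: best_simplex]|].
have -> : G (U, q, best phi U) = gap phi U q.
  by rewrite GE /= [gap phi U (best phi U)]gap_best addr0.
move=> Gle.
apply: le_trans (simplex_l1 sq (best_simplex U)) _.
apply: ler_wpDl; first exact: ltW.
by rewrite -mulrA mulrC -ler_pdivrMr // divff // ler_pdivlMl // mulr1.
Unshelve. all: by end_near. Qed.

End OneStep.

(** * Flows of kernels *)

Section Times.
Variable N : nat.

Lemma time_ind (Q : 'I_N.+1 -> Prop) : Q (time0 N) ->
  (forall k : 'I_N, Q (now k) -> Q (next k)) -> forall k, Q k.
Proof.
move=> Q0 QS [k hk]; elim: k hk => [|k IH] hk.
  by have -> : Ordinal hk = time0 N by apply: val_inj.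
have hk' : (k < N)%N by [].
have -> : Ordinal hk = next (Ordinal hk') by apply: val_inj.
apply: QS; have -> : now (Ordinal hk') = Ordinal (ltnW hk) by apply: val_inj.
exact: IH.
Qed.

Lemma time_ind_back (Q : 'I_N.+1 -> Prop) : Q (timeN N) ->
  (forall k : 'I_N, Q (next k) -> Q (now k)) -> forall k, Q k.
Proof.
move=> QN QS k; have [j] := ubnP (N - k); elim: j k => // j IH k kj.
have [kN|] := eqVneq k ord_max; first by rewrite kN.
move=> /eqP kN; have hk : (k < N)%N.
  rewrite ltn_neqAle -ltnS ltn_ord andbT; apply/eqP => e; apply: kN.
  exact: val_inj.
have -> : k = now (Ordinal hk) by apply: val_inj.
apply: QS; apply: IH => /=; rewrite /bump /= add1n.
by rewrite subnS -ltnS prednK // subn_gt0.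
Qed.

Lemma now_neq_timeN (k : 'I_N) : now k == timeN N = false.
Proof. by apply/negbTE; rewrite -val_eqE /= neq_ltn ltn_ord. Qed.

End Times.

Section Flow.
Variables (R : realType) (S : finType) (N : nat) (M0 : S -> R).
Hypothesis hM0 : simplex M0.
Implicit Types P Q : S -> S -> 'I_N -> R.

Lemma flow_simplex P : kernels P -> simplex_paths (flow M0 P).
Proof.
move=> kP; apply: time_ind => [|k [m01 m1]]; first by rewrite flow0.
apply: simplexE => [x|].
  rewrite flowS; apply: sumr_ge0 => y _; have /andP[m0 _] := m01 y.
  by rewrite mulr_ge0 //; exact: (simplex_ge0 x (kP y k)).
under eq_bigr do rewrite flowS.
rewrite exchange_big /= -m1; apply: eq_bigr => y _.
by rewrite -mulr_sumr; have [_ ->] := kP y k; rewrite mulr1.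
Qed.

(** The mass that already differs is transported by [Q], which does not
    increase [l1]; the rest comes from the two transitions applied to the same
    distribution. *)
Lemma flow_step P Q k : kernels P -> kernels Q ->
  l1 (flow M0 P (next k)) (flow M0 Q (next k)) <=
  l1 (flow M0 P (now k)) (flow M0 Q (now k)) +
  \sum_x flow M0 P (now k) x * l1 (fun y => P x y k) (fun y => Q x y k).
Proof.
move=> kP kQ.
have -> : l1 (flow M0 P (now k)) (flow M0 Q (now k)) =
    \sum_x \sum_y `|flow M0 P (now k) x - flow M0 Q (now k) x| * Q x y k.
  apply: eq_bigr => x _; rewrite -mulr_sumr.
  by have [_ ->] := kQ x k; rewrite mulr1.
under [X in _ + X]eq_bigr do rewrite mulr_sumr.
rewrite exchange_big /= [X in _ + X]exchange_big /= -big_split /=.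
apply: ler_sum => y _; rewrite !flowS -big_split -sumrB /=.
apply: le_trans (ler_norm_sum _ _ _) _; apply: ler_sum => x _.
have Q0 : 0 <= Q x y k := simplex_ge0 y (kQ x k).
have P0 : 0 <= flow M0 P (now k) x := simplex_ge0 x (flow_simplex kP (now k)).
rewrite -[X in _ <= _ * X + _](ger0_norm Q0).
rewrite -[X in _ <= _ + X * _](ger0_norm P0).
rewrite -!normrM; apply: le_trans _ (ler_normD _ _).
by rewrite le_eqVlt; apply/orP; left; apply/eqP; congr (`|_|); ring.
Qed.

End Flow.

(** * Dynamic programming *)

(** The expected cost [K] of moving from [x] with the distribution [p]: together
    with [f x M] it is the expected running cost. *)
Definition kappa (R : realType) (S : finType) (K : S -> S -> (S -> R) -> R)
  (x : S) (p : S -> R) : R := \sum_y p y * K x y p.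

(** Bellman recursion by the number [j] of remaining steps; the time is then
    [N - j]. *)
Fixpoint value_rec (R : realType) (S : finType) (N : nat)
    (K : S -> S -> (S -> R) -> R) (f g : S -> (S -> R) -> R)
    (M : 'I_N.+1 -> S -> R) (j : nat) : S -> R :=
  match j with
  | 0%N => fun x => g x (M (timeN N))
  | j'.+1 => fun x => let U := value_rec K f g M j' in
      f x (M (inord (N - j'.+1))) + score (kappa K x) U (best (kappa K x) U)
  end.

Definition value (R : realType) (S : finType) (N : nat)
    (K : S -> S -> (S -> R) -> R) (f g : S -> (S -> R) -> R)
    (M : 'I_N.+1 -> S -> R) (k : 'I_N.+1) : S -> R :=
  value_rec K f g M (N - k).

Definition policy (R : realType) (S : finType) (N : nat)
    (K : S -> S -> (S -> R) -> R) (f g : S -> (S -> R) -> R)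
    (M : 'I_N.+1 -> S -> R) : S -> S -> 'I_N -> R :=
  fun x y k => best (kappa K x) (value K f g M (next k)) y.

Definition mf_cost (R : realType) (S : finType) (N : nat)
    (f g : S -> (S -> R) -> R) (k : 'I_N.+1) (x : S) (m : S -> R) : R :=
  if k == timeN N then g x m else f x m.

(** What remains of the costs when the path and the kernel are exchanged, see
    [J_cross]. *)
Definition coupling (R : realType) (S : finType) (N : nat)
    (f g : S -> (S -> R) -> R) (M M' m m' : 'I_N.+1 -> S -> R) : R :=
  \sum_k \sum_x
    (mf_cost f g k x (M k) - mf_cost f g k x (M' k)) * (m k x - m' k x).

Definition dist (R : realType) (S : finType) (N : nat)
    (m m' : 'I_N.+1 -> S -> R) : R := \sum_k l1 (m k) (m' k).

(** The excess cost of [P] over the dynamic programming value, read off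
    transition by transition. *)
Definition regret (R : realType) (S : finType) (N : nat) (M0 : S -> R)
    (K : S -> S -> (S -> R) -> R) (f g : S -> (S -> R) -> R)
    (M : 'I_N.+1 -> S -> R) (P : S -> S -> 'I_N -> R) : R :=
  \sum_(k < N) \sum_x flow M0 P (now k) x *
    gap (kappa K x) (value K f g M (next k)) (fun y => P x y k).

Section Dist.
Variables (R : realType) (S : finType) (N : nat).
Implicit Types m : 'I_N.+1 -> S -> R.

Lemma dist_ge0 m m' : 0 <= dist m m'.
Proof. by apply: sumr_ge0 => k _; exact: l1_ge0. Qed.

Lemma distC m m' : dist m m' = dist m' m.
Proof. by apply: eq_bigr => k _; exact: l1C. Qed.

Lemma dist_triangle m2 m1 m3 : dist m1 m3 <= dist m1 m2 + dist m2 m3.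
Proof. by rewrite -big_split; apply: ler_sum => k _; exact: l1_triangle. Qed.

Lemma l1_dist m m' k : l1 (m k) (m' k) <= dist m m'.
Proof.
rewrite /dist (bigD1 k) //= lerDl; apply: sumr_ge0 => i _; exact: l1_ge0.
Qed.

Lemma coord_dist m m' k x : `|m k x - m' k x| <= dist m m'.
Proof. exact: le_trans (l1_coord _ _ x) (l1_dist m m' k). Qed.

Lemma dist_eq0 m m' : dist m m' <= 0 -> m = m'.
Proof.
move=> h; apply/funext => k; apply: l1_eq0.
exact: le_trans (l1_dist _ _ k) h.
Qed.

Lemma dist_simplex m m' : simplex_paths m -> simplex_paths m' ->
  dist m m' <= 2 * N.+1%:R.
Proof.
move=> sm sm'; apply: le_trans (_ : _ <= \sum_(k < N.+1) 2) _.
  by apply: ler_sum => k _; exact: simplex_l1.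
by rewrite sumr_const card_ord mulr_natr.
Qed.

End Dist.

Section Game.
Variables (R : realType) (S : finType) (N : nat) (M0 : S -> R).
Variables (K : S -> S -> (S -> R) -> R) (f g : S -> (S -> R) -> R).
Hypothesis hM0 : simplex M0.
Implicit Types (P Q : S -> S -> 'I_N -> R) (M m : 'I_N.+1 -> S -> R).

(** The probabilities of the transitions sum to 1, so [f] decouples from the
    kernel except through the flow. *)
Lemma J_separable M P : kernels P -> J M0 K f g M P =
  \sum_(k < N) \sum_x flow M0 P (now k) x * kappa K x (fun y => P x y k) +
  \sum_k \sum_x flow M0 P k x * mf_cost f g k x (M k).
Proof.
move=> kP; rewrite big_ord_recr /= addrA -big_split /=; congr (_ + _).
  apply: eq_bigr => k _; rewrite -big_split /=; apply: eq_bigr => x _.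
  rewrite /mf_cost (now_neq_timeN k) -mulrDr.
  under eq_bigr do rewrite -mulrA; rewrite -mulr_sumr; congr (_ * _).
  under eq_bigr do rewrite mulrDr; rewrite big_split /=; congr (_ + _).
  by rewrite -mulr_suml; have [_ ->] := kP x k; rewrite mul1r.
by apply: eq_bigr => x _; rewrite /mf_cost eqxx.
Qed.

(** The part of the cost that comes from [K] does not see the path and
    cancels. *)
Lemma J_cross M M' P Q : kernels P -> kernels Q ->
  J M0 K f g M P - J M0 K f g M' P - (J M0 K f g M Q - J M0 K f g M' Q) =
  coupling f g M M' (flow M0 P) (flow M0 Q).
Proof.
move=> kP kQ; rewrite !J_separable //.
have -> : coupling f g M M' (flow M0 P) (flow M0 Q) =
    \sum_k \sum_x flow M0 P k x * mf_cost f g k x (M k) -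
    \sum_k \sum_x flow M0 P k x * mf_cost f g k x (M' k) -
    (\sum_k \sum_x flow M0 Q k x * mf_cost f g k x (M k) -
     \sum_k \sum_x flow M0 Q k x * mf_cost f g k x (M' k)).
  rewrite -!sumrB; apply: eq_bigr => k _; rewrite -!sumrB.
  by apply: eq_bigr => x _; ring.
pose a P' := \sum_(k < N) \sum_x
  flow M0 P' (now k) x * kappa K x (fun y => P' x y k).
rewrite -/(a P) -/(a Q); ring.
Qed.

Lemma coupling_ge0 M M' : monotone_cost f -> monotone_cost g ->
  simplex_paths M -> simplex_paths M' -> 0 <= coupling f g M M' M M'.
Proof.
move=> mf mg sM sM'; apply: sumr_ge0 => k _; rewrite /mf_cost.
by case: (k == timeN N); [exact: mg | exact: mf].
Qed.

Lemma coupling_bound L M M' m m' : 0 <= L ->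
  (forall k x, `|mf_cost f g k x (M k) - mf_cost f g k x (M' k)| <=
     L * dist M M') ->
  `|coupling f g M M' m m'| <= L * dist M M' * dist m m'.
Proof.
move=> L0 h; apply: le_trans (ler_norm_sum _ _ _) _.
rewrite mulr_sumr; apply: ler_sum => k _.
apply: le_trans (ler_norm_sum _ _ _) _.
by rewrite mulr_sumr; apply: ler_sum => x _; rewrite normrM ler_wpM2r.
Qed.

Lemma mf_cost_lipschitz : lipschitz_cost f -> lipschitz_cost g ->
  exists L, 0 <= L /\ forall M M', simplex_paths M -> simplex_paths M' ->
    forall k x, `|mf_cost f g k x (M k) - mf_cost f g k x (M' k)| <=
      L * dist M M'.
Proof.
move=> [Lf hf] [Lg hg]; exists (`|Lf| + `|Lg|).
split; first by rewrite addr_ge0.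
move=> M M' sM sM' k x.
have le_dist c : c <= `|Lf| + `|Lg| -> c * l1 (M k) (M' k) <=
    (`|Lf| + `|Lg|) * dist M M'.
  move=> cL; apply: le_trans (_ : _ <= (`|Lf| + `|Lg|) * l1 (M k) (M' k)) _.
    by rewrite ler_wpM2r // l1_ge0.
  by rewrite ler_wpM2l ?addr_ge0 // l1_dist.
rewrite /mf_cost; case: (k == timeN N).
  apply: le_trans (hg _ _ _ (sM k) (sM' k)) (le_dist _ _).
  by rewrite (le_trans (ler_norm _)) // lerDr.
apply: le_trans (hf _ _ _ (sM k) (sM' k)) (le_dist _ _).
by rewrite (le_trans (ler_norm _)) // lerDl.
Qed.

Lemma value_timeN M x : value K f g M (timeN N) x = g x (M (timeN N)).
Proof. by rewrite /value /= subnn. Qed.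

Lemma value_now M (k : 'I_N) x : value K f g M (now k) x = f x (M (now k)) +
  score (kappa K x) (value K f g M (next k))
    (best (kappa K x) (value K f g M (next k))).
Proof.
have hk : (N - now k)%N = (N - next k).+1.
  by rewrite /= /bump add1n subnSK.
have e : inord (N - (N - next k).+1) = now k :> 'I_N.+1.
  have kN : (k < N)%N := ltn_ord k.
  by apply: val_inj; rewrite -hk /= subKn ?inordK ?(ltnW kN) // ltnW.
by rewrite {1}/value hk /value_rec e.
Qed.

Lemma flow_next_sum P U (k : 'I_N) :
  \sum_x flow M0 P (next k) x * U x =
  \sum_x flow M0 P (now k) x * pairing (fun y => P x y k) U.
Proof.
under eq_bigr do rewrite flowS mulr_suml.
rewrite exchange_big; apply: eq_bigr => y _; rewrite mulr_sumr.
by apply: eq_bigr => x _; rewrite mulrA.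
Qed.

(** With [T k] the expected value at time [k] along the flow of [P], the
    Bellman equation says that the cost paid at time [k] is
    [T (now k) - T (next k)] plus the expected gap of the transition; summing
    over [k] telescopes. *)
Lemma performance_difference M P : kernels P ->
  J M0 K f g M P =
  \sum_x M0 x * value K f g M (time0 N) x + regret M0 K f g M P.
Proof.
move=> kP; rewrite J_separable //.
pose T k := \sum_x flow M0 P k x * value K f g M k x.
have telescope : \sum_(k < N) T (now k) + T (timeN N) =
    T (time0 N) + \sum_(k < N) T (next k).
  by rewrite -(big_ord_recr (op := +%R)) big_ord_recl.
have -> : regret M0 K f g M P = \sum_(k < N) \sum_x flow M0 P (now k) x *
      (kappa K x (fun y => P x y k) + mf_cost f g (now k) x (M (now k))) +
    \sum_(k < N) T (next k) - \sum_(k < N) T (now k).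
  rewrite -big_split -sumrB; apply: eq_bigr => k _ /=.
  rewrite /T flow_next_sum -big_split -sumrB; apply: eq_bigr => x _ /=.
  rewrite value_now /mf_cost (now_neq_timeN k) /gap {1}/score; ring.
have -> : \sum_x M0 x * value K f g M (time0 N) x =
    \sum_(k < N) T (now k) + T (timeN N) - \sum_(k < N) T (next k).
  by rewrite telescope addrK; apply: eq_bigr => x _; rewrite flow0.
have -> : T (timeN N) = \sum_x flow M0 P (timeN N) x *
    mf_cost f g (timeN N) x (M (timeN N)).
  by apply: eq_bigr => x _; rewrite value_timeN /mf_cost eqxx.
rewrite [X in _ + X = _]big_ord_recr /= addrA -big_split /=.
under eq_bigr do rewrite -big_split /=.
under eq_bigr do under eq_bigr do rewrite -mulrDr.
by rewrite -[ord_max]/(timeN N); ring.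
Qed.

Hypothesis kappa_cont : forall x, {within (@simplex R S : set {ptws S -> R}),
  continuous (kappa K x : {ptws S -> R} -> R)}.
Hypothesis kappa_min : forall x U,
  exists! p, is_argmin (@simplex R S) (score (kappa K x) U) p.

Lemma policy_kernels M : kernels (policy K f g M).
Proof. by move=> x k; exact: (best_simplex (kappa_min x)). Qed.

Lemma regret_ge0 M P : kernels P -> 0 <= regret M0 K f g M P.
Proof.
move=> kP; apply: sumr_ge0 => k _; apply: sumr_ge0 => x _.
apply: mulr_ge0; first exact: (simplex_ge0 x (flow_simplex hM0 kP _)).
exact: (gap_ge0 (kappa_min x)).
Qed.

Lemma regret_policy M : regret M0 K f g M (policy K f g M) = 0.
Proof. by apply: big1 => k _; apply: big1 => x _; rewrite /gap subrr mulr0. Qed.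

Lemma regret_diff M P Q : kernels P -> kernels Q ->
  regret M0 K f g M P - regret M0 K f g M Q =
  J M0 K f g M P - J M0 K f g M Q.
Proof.
by move=> kP kQ; rewrite !performance_difference // opprD addrACA subrr add0r.
Qed.

Lemma policy_argmin M :
  is_argmin (@kernels R S N) (J M0 K f g M) (policy K f g M).
Proof.
split; first exact: policy_kernels.
move=> Q kQ; rewrite -subr_ge0 -regret_diff //; last exact: policy_kernels.
by rewrite regret_policy subr0 regret_ge0.
Qed.

(** Minimizers need not coincide with [policy] where their flow vanishes, so
    they are characterized through the regret. *)
Lemma argmin_regret M P :
  is_argmin (@kernels R S N) (J M0 K f g M) P <->
  kernels P /\ regret M0 K f g M P = 0.
Proof.
have kpi := policy_kernels M.
split=> [[kP mP]|[kP rP]]; split=> //.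
  apply/eqP; rewrite eq_le regret_ge0 // andbT -(regret_policy M) -subr_le0.
  by rewrite regret_diff // subr_le0; exact: mP.
by move=> Q kQ; rewrite -subr_ge0 -regret_diff // rP subr0 regret_ge0.
Qed.

Hypothesis f_lip : lipschitz_cost f.
Hypothesis g_lip : lipschitz_cost g.

Lemma lipschitz_bounded (h : S -> (S -> R) -> R) : lipschitz_cost h ->
  exists B, forall x (m : S -> R), simplex m -> `|h x m| <= B.
Proof.
move=> [L hL]; exists (\sum_x `|h x M0| + `|L| * 2) => x m sm.
have -> : h x m = h x M0 + (h x m - h x M0) by rewrite addrC subrK.
apply: le_trans (ler_normD _ _) _; apply: lerD.
  by rewrite (bigD1 x) //= lerDl sumr_ge0.
apply: le_trans (hL _ _ _ sm hM0) _.
apply: le_trans (_ : `|L| * l1 m M0 <= _).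
  by apply: ler_wpM2r; [exact: l1_ge0 | exact: ler_norm].
by rewrite ler_wpM2l // simplex_l1.
Qed.

(** Provides the box of costs to go that [one_step_stability] asks for. *)
Lemma value_uniform_bound : exists B, forall M, simplex_paths M ->
  forall k x, `|value K f g M k x| <= B.
Proof.
have [Bf hf] := lipschitz_bounded f_lip.
have [Bg hg] := lipschitz_bounded g_lip.
have [Bk hk] := boolp.choice
  (fun x => value_bounded (@kappa_cont x) (@kappa_min x)).
pose C := `|Bf| + `|Bg| + \sum_x `|Bk x|.
have C0 : 0 <= C by rewrite !addr_ge0 // sumr_ge0.
have main M : simplex_paths M -> forall k x,
    `|value K f g M k x| <= (N.+1 - k)%:R * C.
  move=> sM; apply: time_ind_back => [x|k IH x].
    rewrite value_timeN subSn // subnn mul1r.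
    apply: le_trans (hg _ _ (sM _)) _; apply: le_trans (ler_norm _) _.
    by rewrite /C addrAC lerDr addr_ge0 // sumr_ge0.
  rewrite value_now; apply: le_trans (ler_normD _ _) _.
  have -> : (N.+1 - now k)%:R * C = C + (N.+1 - next k)%:R * C :> R.
    rewrite -[C in C + _]mul1r -mulrDl nat1r /= /bump add1n subSS.
    by rewrite subSn // ltnW.
  have -> : C = (`|Bf| + `|Bg|) + \sum_x0 `|Bk x0| by [].
  rewrite -addrA; apply: lerD.
    apply: le_trans (hf _ _ (sM _)) _; apply: le_trans (ler_norm _) _.
    by rewrite lerDl.
  apply: le_trans (hk x _ _ IH) _; apply: lerD => //.
  apply: le_trans (ler_norm _) _.
  by rewrite (bigD1 x) //= lerDl sumr_ge0.
exists (N.+1%:R * C) => M sM k x; apply: le_trans (main M sM k x) _.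
by rewrite ler_wpM2r // ler_nat leq_subr.
Qed.

Lemma value_continuity : exists C, 0 <= C /\
  forall M M', simplex_paths M -> simplex_paths M' -> forall k x,
    `|value K f g M k x - value K f g M' k x| <= C * dist M M'.
Proof.
have [L [L0 hL]] := @mf_cost_lipschitz f_lip g_lip.
have main M M' : simplex_paths M -> simplex_paths M' -> forall k x,
    `|value K f g M k x - value K f g M' k x| <=
    (N.+1 - k)%:R * (L * dist M M').
  move=> sM sM'; apply: time_ind_back => [x|k IH x].
    rewrite !value_timeN subSn // subnn mul1r.
    by have := hL _ _ sM sM' (timeN N) x; rewrite /mf_cost eqxx.
  rewrite !value_now opprD addrACA; apply: le_trans (ler_normD _ _) _.
  have -> : (N.+1 - now k)%:R = 1 + (N.+1 - next k)%:R :> R.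
    rewrite nat1r /= /bump add1n subSS.
    by rewrite subSn // ltnW.
  rewrite mulrDl mul1r; apply: lerD; last exact: value_lipschitz.
  by have := hL _ _ sM sM' (now k) x; rewrite /mf_cost (now_neq_timeN k).
exists (N.+1%:R * L); split; first by rewrite mulr_ge0.
move=> M M' sM sM' k x; apply: le_trans (main M M' sM sM' k x) _.
by rewrite -mulrA ler_wpM2r ?mulr_ge0 ?dist_ge0 // ler_nat leq_subr.
Qed.

(** One-step stability, weighted by the flow of [P], bounds the weighted
    distance of the transitions by a small constant plus a multiple of the
    expected gaps; by [flow_step] the distances of the flows accumulate these
    weighted distances over time. *)
Lemma policy_stability e : 0 < e -> exists C, 0 <= C /\
  forall M P, simplex_paths M -> kernels P ->
    (forall k x, flow M0 P (now k) x *
       l1 (fun y => P x y k) (fun y => policy K f g M x y k) <=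
       e + C * regret M0 K f g M P) /\
    dist (flow M0 P) (flow M0 (policy K f g M)) <=
      e + C * regret M0 K f g M P.
Proof.
move=> e0; have [B hB] := value_uniform_bound.
have n0 : 0 < N.+1%:R :> R by rewrite ltr0n.
(* One factor pays for the sum over the transitions, the other for [dist]. *)
have [e1 [e10 e1E]] : exists e1, 0 < e1 /\ N.+1%:R * (N.+1%:R * e1) = e.
  exists (e / (N.+1%:R * N.+1%:R)).
  split; first by rewrite divr_gt0 // mulr_gt0.
  by rewrite mulrA mulrC divfK // mulf_neq0 // gt_eqF.
have [C0 hC0] := boolp.choice
  (fun x => one_step_stability (@kappa_cont x) (@kappa_min x) B e10).
pose C := \sum_x C0 x.
have C_ge0 : 0 <= C by apply: sumr_ge0 => x _; have [] := hC0 x.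
have CC x : C0 x <= C.
  by rewrite /C (bigD1 x) //= lerDl sumr_ge0 // => y _; have [] := hC0 y.
exists (N.+1%:R * C); split; first by rewrite mulr_ge0 // ltW.
move=> M P sM kP; set pi := policy K f g M.
have kpi : kernels pi by exact: policy_kernels.
have sP := flow_simplex hM0 kP.
pose G k x := flow M0 P (now k) x *
  gap (kappa K x) (value K f g M (next k)) (fun y => P x y k).
have G0 k x : 0 <= G k x.
  apply: mulr_ge0; first exact: (simplex_ge0 x (sP _)).
  exact: (gap_ge0 (kappa_min x)).
pose D k x := flow M0 P (now k) x * l1 (fun y => P x y k) (fun y => pi x y k).
have D0 k x : 0 <= D k x.
  by rewrite mulr_ge0 ?l1_ge0 //; exact: (simplex_ge0 x (sP _)).
have DG k x : D k x <= flow M0 P (now k) x * e1 + C * G k x.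
  have m0 := simplex_ge0 x (sP (now k)).
  apply: le_trans (ler_wpM2l m0 ((hC0 x).2 _ _ (hB M sM (next k)) (kP x k))) _.
  rewrite mulrDr lerD2l mulrCA ler_wpM2r //; exact: G0.
have sumD k : \sum_x D k x <= e1 + C * \sum_x G k x.
  apply: le_trans (ler_sum _ (fun x _ => DG k x)) _.
  by rewrite big_split /= -mulr_suml -mulr_sumr; have [_ ->] := sP (now k);
    rewrite mul1r.
have total : \sum_k \sum_x D k x <= N.+1%:R * e1 + C * regret M0 K f g M P.
  apply: le_trans (ler_sum _ (fun k _ => sumD k)) _.
  rewrite big_split /= -mulr_sumr; apply: lerD => //.
  rewrite sumr_const card_ord -[e1 *+ N]mulr_natl.
  by rewrite ler_wpM2r ?(ltW e10) // ler_nat.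
have total' : N.+1%:R * \sum_k \sum_x D k x <=
    e + N.+1%:R * C * regret M0 K f g M P.
  apply: le_trans (ler_wpM2l (ltW n0) total) _.
  by rewrite mulrDr e1E mulrA.
have le_total : \sum_k \sum_x D k x <= N.+1%:R * \sum_k \sum_x D k x.
  rewrite ler_peMl ?ler1n // sumr_ge0 // => k _; exact: sumr_ge0.
have partial k : l1 (flow M0 P k) (flow M0 pi k) <=
    \sum_(i < N | (i < k)%N) \sum_x D i x.
  move: k; apply: time_ind => [|k IH].
    rewrite !flow0 [leRHS]big_pred0 // /l1 big1 // => x _.
    by rewrite subrr normr0.
  apply: le_trans (flow_step hM0 k kP kpi) _.
  rewrite [leRHS](bigD1 k) /=; last by rewrite /bump add1n.
  rewrite [leRHS]addrC lerD2r; apply: le_trans IH _.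
  rewrite le_eqVlt; apply/orP; left; apply/eqP; apply: eq_bigl => i.
  by rewrite /bump add1n ltnS ltn_neqAle andbC.
split=> [k x|].
  apply: le_trans (le_trans le_total total'); rewrite -/(D k x).
  rewrite (bigD1 k) //= (bigD1 x) //= -addrA lerDl.
  rewrite addr_ge0 // sumr_ge0 // => i _.
  exact: sumr_ge0.
apply: le_trans total'; rewrite /dist mulr_natl -[N.+1 in leRHS]card_ord.
rewrite -sumr_const; apply: ler_sum => k _; apply: le_trans (partial k) _.
rewrite [leRHS](bigID (fun i : 'I_N => (i < k)%N)) /= lerDl sumr_ge0 // => i _.
exact: sumr_ge0.
Qed.

End Game.

(** * Sequences with nonpositive limit superior *)

(** One-sided, so that differences and quantities without a sign can be
    treated; for nonnegative sequences it is convergence to 0. *)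
Definition vanish (R : realType) (u : nat -> R) : Prop :=
  forall e, 0 < e -> exists n0, forall n, (n0 <= n)%N -> u n <= e.

Section Vanish.
Variable R : realType.
Implicit Types u v : nat -> R.

Lemma vanishD u v : vanish u -> vanish v -> vanish (fun n => u n + v n).
Proof.
move=> hu hv e e0; have e2 : 0 < e / 2 by lra.
have [n1 h1] := hu _ e2; have [n2 h2] := hv _ e2.
exists (maxn n1 n2) => n; rewrite geq_max => /andP[/h1 a /h2 b]; lra.
Qed.

(** The form in which the stability estimates are used: the constant [C] may
    blow up as [e] decreases. *)
Lemma vanish_le u v :
  (forall e, 0 < e -> exists C, 0 <= C /\ forall n, u n <= e + C * v n) ->
  vanish v -> vanish u.
Proof.
move=> h hv e e0; have e2 : 0 < e / 2 by lra.
have [C [C0 hC]] := h _ e2; have C1 : 0 < C + 1 by lra.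
have [n0 h0] := hv _ (divr_gt0 e2 C1).
exists n0 => n /h0 vn; apply: le_trans (hC n) _.
rewrite [leRHS](splitr e) lerD2l; apply: le_trans (ler_wpM2l C0 vn) _.
rewrite mulrCA ler_piMr ?(ltW e2) // ler_pdivrMr // mul1r; lra.
Qed.

Lemma vanishW u v : (forall n, u n <= v n) -> vanish v -> vanish u.
Proof.
move=> h; apply: vanish_le => e e0; exists 1; split=> // n.
by rewrite mul1r; apply: le_trans (h n) _; rewrite lerDr ltW.
Qed.

Lemma vanishZ c u : 0 <= c -> vanish u -> vanish (fun n => c * u n).
Proof.
move=> c0; apply: vanish_le => e e0; exists c; split=> // n.
by rewrite lerDr ltW.
Qed.

Lemma vanish_harmonic c : vanish (fun n => c / n.+1%:R : R).
Proof.
move=> e e0; exists (Num.bound (`|c| / e)) => n hn.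
rewrite ler_pdivrMr ?ltr0n //; apply: le_trans (ler_norm c) _.
rewrite mulrC -ler_pdivrMr //.
have /archi_boundP : 0 <= `|c| / e by rewrite divr_ge0 // ltW.
move=> /ltW/le_trans; apply; rewrite ler_nat; exact: leqW.
Qed.

(** After some index [a] grows by at most [e / 2] in each step, and its value at
    that index is negligible after division by [n]. *)
Lemma vanish_average (a b : nat -> R) :
  (forall n, a n.+1 <= a n + b n) -> vanish b ->
  vanish (fun n => a n / n.+1%:R).
Proof.
move=> hab hb e e0; have e2 : 0 < e / 2 by lra.
have [n0 h0] := hb _ e2.
have growth j : a (n0 + j)%N <= a n0 + j%:R * (e / 2).
  elim: j => [|j IH]; first by rewrite addn0 mul0r addr0.
  rewrite addnS -natr1; apply: le_trans (hab _) _.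
  by have := h0 (n0 + j)%N (leq_addr _ _); lra.
have [n1 h1] := vanish_harmonic (a n0) e2.
exists (maxn n0 n1) => n; rewrite geq_max => /andP[n0n /h1].
rewrite !ler_pdivrMr ?ltr0n // => h1n.
have := growth (n - n0)%N; rewrite subnKC //.
have : (n - n0)%:R * (e / 2) <= n.+1%:R * (e / 2).
  by rewrite ler_wpM2r ?(ltW e2) // ler_nat leqW // leq_subr.
lra.
Qed.

Lemma vanish_shift u :
  vanish (fun n => u n.+1) -> vanish u.
Proof.
move=> h e e0; have [n0 h0] := h e e0; exists n0.+1 => -[//|n]; exact: h0.
Qed.

Lemma vanish_cvg u l : vanish (fun n => `|u n - l|) -> u n @[n --> \oo] --> l.
Proof.
move=> h; apply/cvgrPdist_le => e e0; have [n0 h0] := h _ e0.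
by exists n0 => // n /h0; rewrite distrC.
Qed.

Lemma cvg_vanish u l : u n @[n --> \oo] --> l -> vanish (fun n => `|u n - l|).
Proof.
move=> /cvgrPdist_le h e e0; have [n0 _ h0] := h e e0.
by exists n0 => n /h0; rewrite distrC.
Qed.

Lemma vanish_sum (I : finType) (w : I -> nat -> R) :
  (forall i, vanish (w i)) -> vanish (fun n => \sum_i w i n).
Proof.
move=> h; elim: (index_enum I) => [|i r IH].
  by move=> e e0; exists 0%N => n _; rewrite big_nil ltW.
apply: vanishW (vanishD (h i) IH) => n; by rewrite big_cons.
Qed.

Lemma le0_of_le_eps (x : R) : (forall e, 0 < e -> x <= e) -> x <= 0.
Proof. by move=> h; apply/ler_addgt0Pr => e e0; rewrite add0r; exact: h. Qed.

Lemma vanish_cst x : vanish (fun=> x : R) -> x <= 0.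
Proof.
move=> h; apply: le0_of_le_eps => e /h[n0]; apply; exact: leqnn.
Qed.

Lemma vanish_cauchy u :
  (forall e, 0 < e -> exists n0, forall p q, (n0 <= p)%N -> (n0 <= q)%N ->
    `|u p - u q| <= e) ->
  exists l, vanish (fun n => `|u n - l|).
Proof.
move=> h; exists (limn u); apply: cvg_vanish; apply/cauchy_cvgP.
apply/cauchy_ballP => e e0.
have e2 : 0 < e / 2 by lra.
have [n0 h0] := h _ e2.
pose tail := u @` [set n | (n0 <= n)%N].
exists (tail, tail); first by split; exists n0 => // n hn; exists n.
move=> [_ _] /= [[p hp <-] [q hq <-]]; rewrite /ball /=.
by have := h0 p q hp hq; lra.
Qed.

End Vanish.

(** * Dependence of best responses on the path *)

Section Responses.
Variables (R : realType) (S : finType) (N : nat) (M0 : S -> R).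
Variables (K : S -> S -> (S -> R) -> R) (f g : S -> (S -> R) -> R).
Hypothesis hM0 : simplex M0.
Hypothesis kappa_cont : forall x, {within (@simplex R S : set {ptws S -> R}),
  continuous (kappa K x : {ptws S -> R} -> R)}.
Hypothesis kappa_min : forall x U,
  exists! p, is_argmin (@simplex R S) (score (kappa K x) U) p.
Hypothesis f_lip : lipschitz_cost f.
Hypothesis g_lip : lipschitz_cost g.
Implicit Types (P Q : S -> S -> 'I_N -> R) (M m : 'I_N.+1 -> S -> R).

Notation total_cost := (J M0 K f g).
Notation best_response M := (is_argmin (@kernels R S N) (total_cost M)).
Notation diam := (2 * N.+1%:R : R).

(** Zero regret in [policy_stability], for every [e]. *)
Lemma response_policy M P : simplex_paths M -> best_response M P ->
  flow M0 P = flow M0 (policy K f g M) /\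
  forall x y k, 0 < flow M0 P (now k) x -> P x y k = policy K f g M x y k.
Proof.
move=> sM /(argmin_regret f g hM0 kappa_min)[kP rP].
split=> [|x y k Px].
  apply: dist_eq0; apply: le0_of_le_eps => e e0.
  have [C [_ /(_ M P sM kP)[_]]] :=
    policy_stability N hM0 kappa_cont kappa_min f_lip g_lip e0.
  by rewrite rP mulr0 addr0.
suff /l1_eq0/(congr1 (fun p => p y)) :
  l1 (fun y => P x y k) (fun y => policy K f g M x y k) <= 0 by [].
rewrite -(pmulr_rle0 _ Px); apply: le0_of_le_eps => e e0.
have [C [_ /(_ M P sM kP)[+ _]]] :=
  policy_stability N hM0 kappa_cont kappa_min f_lip g_lip e0.
by move=> /(_ k x); rewrite rP mulr0 addr0.
Qed.

Lemma response_stability e : 0 < e -> exists C, 0 <= C /\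
  forall M P Q, simplex_paths M -> best_response M P -> kernels Q ->
    dist (flow M0 Q) (flow M0 P) <= e + C * (total_cost M Q - total_cost M P).
Proof.
move=> e0; have [C [C0 hC]] :=
  policy_stability N hM0 kappa_cont kappa_min f_lip g_lip e0.
exists C; split=> // M P Q sM oP kQ.
rewrite (response_policy sM oP).1.
have /(argmin_regret f g hM0 kappa_min)[kP rP] := oP.
by rewrite -regret_diff // rP subr0; have [] := hC M Q sM kQ.
Qed.

Lemma coupling_lipschitz : exists L, 0 <= L /\
  forall M M' m m', simplex_paths M -> simplex_paths M' ->
    `|coupling f g M M' m m'| <= L * dist M M' * dist m m'.
Proof.
have [L [L0 hL]] := mf_cost_lipschitz N f_lip g_lip.
exists L; split=> // M M' m m' sM sM'.
by apply: coupling_bound => // k x; apply: hL.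
Qed.

(** [P'] is optimal for [M'], so what it loses against [P] for [M] is at most
    the cross difference of [J_cross]. *)
Lemma response_cost : exists L, 0 <= L /\
  forall M M' P P', simplex_paths M -> simplex_paths M' ->
    best_response M P -> best_response M' P' ->
    total_cost M P' - total_cost M P <= L * dist M M'.
Proof.
have [L [L0 hL]] := coupling_lipschitz.
exists (L * diam); split; first by rewrite !mulr_ge0.
move=> M M' P P' sM sM' [kP oP] [kP' oP'].
have := J_cross M0 K f g M M' kP' kP.
have := hL M M' (flow M0 P') (flow M0 P) sM sM'.
have := dist_simplex (flow_simplex hM0 kP') (flow_simplex hM0 kP).
move=> /(ler_wpM2l (mulr_ge0 L0 (dist_ge0 M M'))) d /(le_trans (ler_norm _)).
by have := oP' _ kP; rewrite mulrAC; lra.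
Qed.

Lemma response_continuity e : 0 < e -> exists C, 0 <= C /\
  forall M M' P P', simplex_paths M -> simplex_paths M' ->
    best_response M P -> best_response M' P' ->
    dist (flow M0 P') (flow M0 P) <= e + C * dist M M'.
Proof.
move=> e0; have [C [C0 hC]] := response_stability e0.
have [L [L0 hL]] := response_cost.
exists (C * L); split; first exact: mulr_ge0.
move=> M M' P P' sM sM' oP oP'; have [kP' _] := oP'.
apply: le_trans (hC M P P' sM oP kP') _.
by rewrite lerD2l -mulrA ler_wpM2l //; apply: hL.
Qed.

Lemma policy_continuity e : 0 < e -> exists C, 0 <= C /\
  forall M M' x k, simplex_paths M -> simplex_paths M' ->
    l1 (fun y => policy K f g M' x y k) (fun y => policy K f g M x y k)
      <= e + C * dist M M'.
Proof.
move=> e0.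
have [B hB] := value_uniform_bound N hM0 kappa_cont kappa_min f_lip g_lip.
have [D [D0 hD]] := value_continuity N kappa_min f_lip g_lip.
have [c hc] := boolp.choice
  (fun x => one_step_stability (@kappa_cont x) (@kappa_min x) B e0).
pose C := \sum_x c x.
have cC x : c x <= C.
  by rewrite /C (bigD1 x) //= lerDl sumr_ge0 // => y _; have [] := hc y.
have C0 : 0 <= C by apply: sumr_ge0 => x _; have [] := hc x.
exists (C * (2 * D)); split; first by rewrite !mulr_ge0.
move=> M M' x k sM sM'.
apply: le_trans ((hc x).2 _ _ (hB M sM (next k))
  (policy_kernels f g kappa_min M' x k)) _.
rewrite lerD2l; apply: le_trans (_ : C * gap (kappa K x)
    (value K f g M (next k)) (fun y => policy K f g M' x y k) <= _).
  rewrite ler_wpM2r //; apply: (gap_ge0 (kappa_min x)).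
  exact: policy_kernels.
rewrite -mulrA ler_wpM2l // -mulrA; apply: (gap_best_lipschitz (kappa_min x)).
by move=> y; apply: hD.
Qed.

End Responses.

(** * Convergence of fictitious play *)

Section Play.
Variables (R : realType) (S : finType) (N : nat) (M0 : S -> R).
Variables (K : S -> S -> (S -> R) -> R) (f g : S -> (S -> R) -> R).
Hypothesis hM0 : simplex M0.
Hypothesis kappa_cont : forall x, {within (@simplex R S : set {ptws S -> R}),
  continuous (kappa K x : {ptws S -> R} -> R)}.
Hypothesis kappa_min : forall x U,
  exists! p, is_argmin (@simplex R S) (score (kappa K x) U) p.
Hypothesis f_lip : lipschitz_cost f.
Hypothesis g_lip : lipschitz_cost g.
Hypothesis f_mon : monotone_cost f.
Hypothesis g_mon : monotone_cost g.

Notation total_cost := (J M0 K f g).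
Notation best_response M := (is_argmin (@kernels R S N) (total_cost M)).
Notation diam := (2 * N.+1%:R : R).

(* Indices are shifted by one with respect to the usual numbering: [B 0] is the
   initial path and [B n] is an average of [n + 1] paths. *)
Variables (P : nat -> S -> S -> 'I_N -> R) (B : nat -> 'I_N.+1 -> S -> R).
Hypothesis B_path0 : simplex_paths (B 0).
Hypothesis P_best : forall n, best_response (B n) (P n).
Hypothesis B_step : forall n k x,
  n.+2%:R * B n.+1 k x = n.+1%:R * B n k x + flow M0 (P n) k x.

Let m n := flow M0 (P n).

Let P_kernels n : kernels (P n). Proof. by have [] := P_best n. Qed.

Let m_path n : simplex_paths (m n). Proof. exact: flow_simplex. Qed.

Let natr_gt0 n : 0 < n.+1%:R :> R. Proof. by rewrite ltr0n. Qed.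

Lemma belief_path n : simplex_paths (B n).
Proof.
elim: n => // n IH k; apply: simplexE => [x|].
  rewrite -(pmulr_rge0 _ (natr_gt0 n.+1)) B_step addr_ge0 ?mulr_ge0 //.
    exact: (simplex_ge0 x (IH k)).
  exact: (simplex_ge0 x (m_path n k)).
apply: (mulfI (lt0r_neq0 (natr_gt0 n.+1))).
rewrite mulr_sumr; under eq_bigr do rewrite B_step.
rewrite big_split -mulr_sumr /=; have [_ ->] := IH k.
by have [_ ->] := m_path n k; rewrite !mulr1 natr1.
Qed.

Lemma belief_sum n k x :
  n.+1%:R * B n k x = B 0 k x + \sum_(i < n) m i k x.
Proof.
elim: n => [|n IH]; first by rewrite mul1r big_ord0 addr0.
by rewrite big_ord_recr /= addrA -IH B_step.
Qed.

(** The new flow minus the new average points in the direction of the last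
    increment of the average: this is where monotonicity becomes usable. *)
Lemma belief_incr n k x :
  m n k x - B n.+1 k x = n.+1%:R * (B n.+1 k x - B n k x).
Proof.
have := B_step n k x; rewrite -[n.+2%:R]natr1 -/(m n) => h; lra.
Qed.

Lemma dist_belief n : dist (B n) (B n.+1) <= diam / n.+1%:R.
Proof.
rewrite ler_pdivlMr // mulrC.
apply: le_trans (dist_simplex (m_path n) (@belief_path n.+1)).
rewrite /dist mulr_sumr; apply: ler_sum => k _.
rewrite /l1 mulr_sumr; apply: ler_sum => x _.
rewrite belief_incr normrM ger0_norm ?ler0n // ler_wpM2l ?ler0n //.
by rewrite distrC.
Qed.

Lemma dist_belief_vanish : vanish (fun n => dist (B n) (B n.+1)).
Proof. exact: vanishW dist_belief (vanish_harmonic diam). Qed.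

Lemma consecutive_flows_vanish : vanish (fun n => dist (m n) (m n.+1)).
Proof.
apply: vanish_le dist_belief_vanish => e e0.
have [C [C0 hC]] :=
  response_continuity N hM0 kappa_cont kappa_min f_lip g_lip e0.
exists C; split=> // n; rewrite distC.
exact: hC (@belief_path n) (@belief_path n.+1) (P_best n) (P_best n.+1).
Qed.

(** How much worse than [P n] the past responses are, in total, against the
    current average [B n]. *)
Let excess n := \sum_(i < n) (total_cost (B n) (P i) - total_cost (B n) (P n)).

(** [P n] is at least as good as [P n.+1] against [B n]; putting [P n.+1] in its
    place turns the increment into a sum of the differences of [J_cross]. *)
Lemma excess_step n : excess n.+1 - excess n <=
  \sum_(i < n.+1) coupling f g (B n.+1) (B n) (m i) (m n.+1).
Proof.
have -> : excess n =
    \sum_(i < n.+1) (total_cost (B n) (P i) - total_cost (B n) (P n)).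
  by rewrite big_ord_recr /= subrr addr0.
rewrite -sumrB; apply: ler_sum => i _.
rewrite -(J_cross M0 K) //.
by have [_ /(_ _ (P_kernels n.+1))] := P_best n; lra.
Qed.

(** Uses [belief_sum] for the sum of the past flows and [belief_incr] for the
    last one; the first term on the right is nonpositive for monotone costs. *)
Lemma coupling_sum n :
  \sum_(i < n.+1) coupling f g (B n.+1) (B n) (m i) (m n.+1) =
  - (n.+1%:R * n.+1%:R * coupling f g (B n.+1) (B n) (B n.+1) (B n)) +
  n.+1%:R * coupling f g (B n.+1) (B n) (m n) (m n.+1) +
  coupling f g (B n.+1) (B n) (B n.+1) (B 0).
Proof.
rewrite exchange_big /= !mulr_sumr -sumrN -!big_split /=.
apply: eq_bigr => k _; rewrite exchange_big /= !mulr_sumr -sumrN -!big_split /=.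
apply: eq_bigr => x _; rewrite -mulr_sumr sumrB sumr_const card_ord.
set h := _ - _.
have -> : \sum_(i < n.+1) m i k x = n.+2%:R * B n.+1 k x - B 0 k x.
  by rewrite belief_sum addrC addKr.
have := belief_incr n k x; rewrite -[n.+2%:R]natr1 -[_ *+ n.+1]mulr_natl => e.
have -> : m n k x = B n.+1 k x + n.+1%:R * (B n.+1 k x - B n k x) by lra.
by ring.
Qed.

(** In [coupling_sum] the factor [n + 1] of the second term is absorbed by
    [dist_belief], and the last term is of the order of one increment. *)
Lemma excess_average_vanish : vanish (fun n => excess n / n.+1%:R).
Proof.
have [L [L0 hL]] := coupling_lipschitz N f_lip g_lip.
have d0 : 0 <= diam by rewrite mulr_ge0.
apply: (@vanish_average _ _ (fun n =>
  L * diam * dist (m n) (m n.+1) + L * diam * dist (B n) (B n.+1))).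
  move=> n; rewrite -lerBlDl; apply: le_trans (excess_step n) _.
  rewrite coupling_sum.
  have mono : 0 <= n.+1%:R * n.+1%:R *
      coupling f g (B n.+1) (B n) (B n.+1) (B n).
    rewrite !mulr_ge0 //; apply: coupling_ge0 => //; exact: belief_path.
  have Ld : 0 <= L * dist (B n.+1) (B n) by rewrite mulr_ge0 ?dist_ge0.
  have a1 : n.+1%:R * coupling f g (B n.+1) (B n) (m n) (m n.+1) <=
      L * diam * dist (m n) (m n.+1).
    apply: le_trans (_ : n.+1%:R * (L * dist (B n.+1) (B n) *
      dist (m n) (m n.+1)) <= _).
      rewrite ler_wpM2l // (le_trans (ler_norm _)) // hL //; exact: belief_path.
    have step : n.+1%:R * dist (B n.+1) (B n) <= diam.
      by rewrite mulrC -ler_pdivlMr // distC; exact: dist_belief.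
    by have := ler_wpM2l (mulr_ge0 L0 (dist_ge0 (m n) (m n.+1))) step; lra.
  have a2 : coupling f g (B n.+1) (B n) (B n.+1) (B 0) <=
      L * diam * dist (B n) (B n.+1).
    apply: le_trans (ler_norm _) _.
    apply: le_trans (hL _ _ _ _ (@belief_path _) (@belief_path _)) _.
    rewrite mulrAC [dist (B n.+1) (B n)]distC ler_wpM2r ?dist_ge0 //.
    rewrite ler_wpM2l // dist_simplex //; exact: belief_path.
  lra.
apply: vanishD; apply: vanishZ; rewrite ?mulr_ge0 //.
  exact: consecutive_flows_vanish.
exact: dist_belief_vanish.
Qed.

(** [n + 1] times the distance of [m n] from the average is at most the sum of
    its distances from the past flows, up to the initial path.  Stability bounds
    each of these by the excess cost of the past response, and the excess costs
    add up to [excess n]. *)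
Lemma flow_belief_vanish : vanish (fun n => dist (m n) (B n)).
Proof.
suff h : vanish (fun n => dist (m n) (B n) - diam / n.+1%:R).
  apply: vanishW (vanishD h (vanish_harmonic diam)) => n.
  by rewrite subrK.
apply: vanish_le excess_average_vanish => e e0.
have [C [C0 hC]] :=
  response_stability N hM0 kappa_cont kappa_min f_lip g_lip e0.
exists C; split=> // n.
have key : n.+1%:R * dist (m n) (B n) <=
    dist (m n) (B 0) + \sum_(i < n) dist (m n) (m i).
  rewrite /dist [X in _ + X]exchange_big mulr_sumr -big_split.
  apply: ler_sum => k _ /=; rewrite /l1 [X in _ + X]exchange_big mulr_sumr.
  rewrite -big_split; apply: ler_sum => x _ /=.
  rewrite -[X in X * _ <= _](ger0_norm (ltW (natr_gt0 n))) -normrM.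
  have -> : n.+1%:R * (m n k x - B n k x) =
      (m n k x - B 0 k x) + \sum_(i < n) (m n k x - m i k x).
    rewrite mulrBr belief_sum sumrB sumr_const card_ord -natr1.
    by rewrite -[m n k x *+ n]mulr_natl; ring.
  by apply: le_trans (ler_normD _ _) _; rewrite lerD2l ler_norm_sum.
have sumC : \sum_(i < n) dist (m n) (m i) <= n.+1%:R * e + C * excess n.
  apply: le_trans (_ : \sum_(i < n)
      (e + C * (total_cost (B n) (P i) - total_cost (B n) (P n))) <= _).
    apply: ler_sum => i _; rewrite distC; apply: hC => //.
    exact: belief_path.
  rewrite big_split /= -mulr_sumr lerD2r sumr_const card_ord.
  by rewrite -[e *+ n]mulr_natl ler_wpM2r ?(ltW e0) // ler_nat.
rewrite lerBlDr -(ler_pM2l (natr_gt0 n)) !mulrDr.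
rewrite [n.+1%:R * (C * _)]mulrCA [n.+1%:R * (_ / _)]mulrCA.
rewrite [n.+1%:R * (diam / _)]mulrCA divff ?gt_eqF // !mulr1.
by have := dist_simplex (m_path n) B_path0; lra.
Qed.

(** The excess of [P q] against [B p] plus that of [P p] against [B q] is the
    coupling of the averages with the flows.  Up to terms controlled by
    [flow_belief_vanish] the flows may be replaced by the averages, and then the
    coupling is nonpositive. *)
Lemma flow_cauchy e : 0 < e -> exists n0, forall p q,
  (n0 <= p)%N -> (n0 <= q)%N -> dist (m p) (m q) <= e.
Proof.
move=> e0; have e2 : 0 < e / 2 by lra.
have [C [C0 hC]] :=
  response_stability N hM0 kappa_cont kappa_min f_lip g_lip e2.
have [L [L0 hL]] := coupling_lipschitz N f_lip g_lip.
have A0 : 0 <= C * (L * diam) by rewrite !mulr_ge0.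
have e4 : 0 < e / 4 by lra.
have [n0 h0] := vanishZ A0 flow_belief_vanish e4.
exists n0 => p q /h0 hp /h0 hq.
rewrite distC; apply: le_trans (hC (B p) (P p) (P q) _ _ _) _ => //.
  exact: belief_path.
have cross := J_cross M0 K f g (B p) (B q) (P_kernels q) (P_kernels p).
have split3 : coupling f g (B p) (B q) (m q) (m p) =
    coupling f g (B p) (B q) (m q) (B q) -
    coupling f g (B p) (B q) (m p) (B p) -
    coupling f g (B p) (B q) (B p) (B q).
  rewrite -!sumrB; apply: eq_bigr => k _; rewrite -!sumrB.
  by apply: eq_bigr => x _; ring.
have mono := coupling_ge0 f_mon g_mon (belief_path p) (belief_path q).
have bound n : `|coupling f g (B p) (B q) (m n) (B n)| <=
    L * diam * dist (m n) (B n).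
  apply: le_trans (hL _ _ _ _ (belief_path p) (belief_path q)) _.
  rewrite ler_wpM2r ?dist_ge0 // ler_wpM2l // dist_simplex //;
    exact: belief_path.
have := bound p; have := bound q; rewrite !ler_norml => /andP[_ bq] /andP[bp _].
have [_ /(_ _ (P_kernels p)) oq] := P_best q.
have gap_le : total_cost (B p) (P q) - total_cost (B p) (P p) <=
    L * diam * dist (m p) (B p) + L * diam * dist (m q) (B q) by lra.
have := ler_wpM2l C0 gap_le; rewrite mulrDr !mulrA; move: hp hq; rewrite !mulrA.
lra.
Qed.

Lemma flow_limit : exists Ms, simplex_paths Ms /\
  vanish (fun n => dist (m n) Ms).
Proof.
have coord k : exists h : S -> R, forall x, vanish (fun n => `|m n k x - h x|).
  have [h hh] := boolp.choice (fun x => vanish_cauchy (u := fun n => m n k x)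
    (fun e e0 => let: ex_intro n0 h0 := flow_cauchy e0 in
      ex_intro _ n0 (fun p q hp hq =>
        le_trans (coord_dist (m p) (m q) k x) (h0 p q hp hq)))).
  by exists h.
have [Ms hMs] := boolp.choice coord.
have lim : vanish (fun n => dist (m n) Ms).
  by apply: vanish_sum => k; apply: vanish_sum => x; exact: hMs.
exists Ms; split=> // k; apply: simplexE => [x|].
  rewrite -oppr_le0; apply: le0_of_le_eps => e e0.
  have [n0 /(_ _ (leqnn _))] := hMs k x e e0; rewrite ler_norml => /andP[_].
  by have := simplex_ge0 x (m_path n0 k); lra.
apply/eqP; rewrite -subr_eq0 -normr_le0; apply: le0_of_le_eps => e e0.
have [n0 /(_ _ (leqnn _))] := lim e e0; apply: le_trans.
have [_ <-] := m_path n0 k; rewrite distrC -sumrB.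
by apply: le_trans (ler_norm_sum _ _ _) _; exact: l1_dist.
Qed.

Section Limit.
Variable Ms : 'I_N.+1 -> S -> R.
Hypothesis Ms_path : simplex_paths Ms.
Hypothesis m_lim : vanish (fun n => dist (m n) Ms).

Lemma belief_limit : vanish (fun n => dist (B n) Ms).
Proof.
apply: vanishW (vanishD flow_belief_vanish m_lim) => n.
by rewrite [dist (m n) (B n)]distC; exact: dist_triangle.
Qed.

Let policy_best := policy_argmin f g hM0 kappa_min Ms.

(** [m n] responds to [B n], which tends to [Ms], so by continuity [m n] tends
    to the flow of the response to [Ms]. *)
Lemma limit_fixed_point : flow M0 (policy K f g Ms) = Ms.
Proof.
apply: dist_eq0; apply: vanish_cst.
apply: vanishW (vanishD _ m_lim); last first.
  apply: vanish_le belief_limit => e e0.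
  have [C [C0 hC]] :=
    response_continuity N hM0 kappa_cont kappa_min f_lip g_lip e0.
  exists C; split=> // n.
  exact: hC (@belief_path n) Ms_path (P_best n) policy_best.
by move=> n /=; exact: dist_triangle.
Qed.

(** [policy_stability] controls the transitions only after multiplication by the
    flow, which is eventually at least half of its positive limit. *)
Lemma kernel_limit_visited x y k : 0 < Ms (now k) x ->
  vanish (fun n => `|P n x y k - policy K f g Ms x y k|).
Proof.
move=> Mx; set a := Ms (now k) x.
have a2 : 0 < a / 2 by rewrite divr_gt0.
have weighted : vanish (fun n => m n (now k) x *
    l1 (fun y => P n x y k) (fun y => policy K f g Ms x y k)).
  have [L [L0 hL]] := response_cost N K hM0 f_lip g_lip.
  apply: vanish_le (vanishZ L0 belief_limit) => e e0.
  have [C [C0 hC]] :=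
    policy_stability N hM0 kappa_cont kappa_min f_lip g_lip e0.
  exists C; split=> // n.
  apply: le_trans ((hC Ms (P n) Ms_path (P_kernels n)).1 k x) _.
  rewrite lerD2l ler_wpM2l // -[leLHS]subr0 -(regret_policy M0 K f g Ms).
  rewrite regret_diff //; last exact: policy_kernels.
  by rewrite distC; apply: hL => //; exact: belief_path.
move=> e e0; have [n1 h1] := weighted _ (mulr_gt0 a2 e0).
have [n2 h2] := m_lim a2; exists (maxn n1 n2) => n.
rewrite geq_max => /andP[/h1 u /h2 v].
have mn : a / 2 <= m n (now k) x.
  have := le_trans (coord_dist (m n) Ms (now k) x) v.
  by rewrite ler_norml -/a => /andP[+ _]; lra.
apply: le_trans (l1_coord (fun y => P n x y k)
  (fun y => policy K f g Ms x y k) y) _.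
rewrite -(ler_pM2l a2); apply: le_trans u.
by rewrite ler_wpM2r // l1_ge0.
Qed.

Lemma kernel_limit x y k : (forall n, P n = policy K f g (B n)) ->
  vanish (fun n => `|P n x y k - policy K f g Ms x y k|).
Proof.
move=> hP; apply: vanish_le belief_limit => e e0.
have [C [C0 hC]] :=
  policy_continuity N hM0 kappa_cont kappa_min f_lip g_lip e0.
exists C; split=> // n; rewrite hP [dist _ _]distC.
apply: le_trans (hC Ms (B n) x k Ms_path (@belief_path n)).
exact: (l1_coord (fun y => policy K f g (B n) x y k)).
Qed.

End Limit.

(** By monotonicity the two losses incurred by exchanging the equilibria add up
    to at most 0; both are nonnegative, so [Q'] is as good as [Q] against the
    flow of [Q]. *)
Lemma equilibrium_response Q Q' :
  mfg_solution M0 K f g Q -> mfg_solution M0 K f g Q' ->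
  best_response (flow M0 Q) Q'.
Proof.
move=> [kQ oQ] [kQ' oQ']; split=> // Z kZ; apply: le_trans _ (oQ Z kZ).
have := J_cross M0 K f g (flow M0 Q) (flow M0 Q') kQ kQ'.
have := coupling_ge0 f_mon g_mon (flow_simplex hM0 kQ) (flow_simplex hM0 kQ').
by have := oQ' _ kQ; lra.
Qed.

End Play.

(** * The one-step problems of the game *)

Lemma argmin_shift (R : realType) (T : Type) (A : set T) (F G : T -> R) c p :
  (forall q, A q -> F q = G q + c) -> is_argmin A F p <-> is_argmin A G p.
Proof.
move=> h; split=> -[Ap mp]; split=> // q Aq; have := mp q Aq.
  by rewrite !h // lerD2r.
by rewrite !h // lerD2r.
Qed.

Section Separation.
Variables (R : realType) (S : finType) (M0 : S -> R).
Variables (K : S -> S -> (S -> R) -> R) (f g : S -> (S -> R) -> R).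
Hypothesis hM0 : simplex M0.

Lemma one_step_cost x (p U : S -> R) : simplex p ->
  \sum_y p y * (cost K f x y p M0 + U y) = score (kappa K x) U p + f x M0.
Proof.
move=> [_ p1]; rewrite /score /kappa /pairing -big_split /=.
rewrite -[f x M0 in RHS]mul1r -p1 mulr_suml -big_split /=.
by apply: eq_bigr => y _; rewrite /cost; ring.
Qed.

(** Once [M] is fixed, [f] only adds a constant on the simplex. *)
Lemma kappa_unique_minimizers : unique_one_step_minimizers K f ->
  forall x U, exists! p, is_argmin (@simplex R S) (score (kappa K x) U) p.
Proof.
move=> h2 x U; have [p [op up]] := h2 U M0 x hM0.
have e q := argmin_shift q (fun p sp => @one_step_cost x p U sp).
by exists p; split=> [|q oq]; [exact/e | apply/up/e].
Qed.

Lemma kappa_continuous : costs_continuous K f g ->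
  forall x, {within (@simplex R S : set {ptws S -> R}),
    continuous (kappa K x : {ptws S -> R} -> R)}.
Proof.
move=> h1 x; have [_ hx] := h1 x.
pose V := {ptws S -> R}.
have kE p : simplex p ->
    \sum_y p y * cost K f x y p M0 - f x M0 = kappa K x p.
  move=> [_ p1]; rewrite -[f x M0 in LHS]mul1r -p1 mulr_suml -sumrB.
  by apply: eq_bigr => y _; rewrite /cost; ring.
apply/subspace_continuousP => p sp.
have lim : (fun q : V => \sum_y q y * cost K f x y q M0 - f x M0)
    @ within (@simplex R S : set V) (nbhs (p : V)) -->
    \sum_y p y * cost K f x y p M0 - f x M0.
  apply: cvgB; last exact: cvg_cst.
  move/subspace_continuousP: hx => /(_ (p, M0) (conj sp hM0)) hx.
  apply: (@cvg_comp _ _ _ (fun q : V => (q, M0 : V)) _ _ _ _ _ hx).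
  apply: cvg_within_set.
    have c1 : (fun q : V => q) @ within (@simplex R S : set V) (nbhs (p : V))
        --> (p : V) by exact: cvg_within.
    have c2 : (fun=> M0 : V) @ within (@simplex R S : set V) (nbhs (p : V))
        --> (M0 : V) by exact: (@cvg_cst V).
    exact: (cvg_pair c1 c2).
  by near=> q; split=> //=; near: q; exact: withinT.
rewrite (kE p sp) in lim; apply: cvg_trans lim.
by apply: fmap_within_eq => q /set_mem sq; exact/esym/kE.
Unshelve. all: by end_near. Qed.

End Separation.

(** * Convergence to the equilibrium *)

Theorem theorem3p2 (R : realType) (S : finType) (N : nat)
    (M0 : S -> R) (K : S -> S -> (S -> R) -> R) (f g : S -> (S -> R) -> R)
    (P : nat -> S -> S -> 'I_N -> R) (M Mbar : nat -> 'I_N.+1 -> S -> R)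
    (hM0 : simplex M0)
    (h1 : costs_continuous K f g)
    (h2 : unique_one_step_minimizers K f)
    (h3 : monotone_cost f /\ monotone_cost g)
    (h4 : lipschitz_cost f /\ lipschitz_cost g)
    (hfp : fictitious_play M0 K f g P M Mbar) :
  (* where the problems inf_P J_M(P) are uniquely solvable *)
  (unique_minimizers N M0 K f g ->
   exists Phat : S -> S -> 'I_N -> R,
     [/\ mfg_solution M0 K f g Phat,
         forall Q, mfg_solution M0 K f g Q -> Q = Phat,
         forall x y k, P n x y k @[n --> \oo] --> Phat x y k,
         paths_cvg M (flow M0 Phat) &
         paths_cvg Mbar (flow M0 Phat)])
  /\
  (* in general, for any choice of the minimizers P n: the same, except at
     the states that are not visited at equilibrium *)
  (exists Phat : S -> S -> 'I_N -> R,
     [/\ mfg_solution M0 K f g Phat,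
         forall Q, mfg_solution M0 K f g Q ->
           flow M0 Q = flow M0 Phat /\
           forall x y k, 0 < flow M0 Phat (now k) x -> Q x y k = Phat x y k,
         forall x y k, 0 < flow M0 Phat (now k) x ->
           P n x y k @[n --> \oo] --> Phat x y k,
         paths_cvg M (flow M0 Phat) &
         paths_cvg Mbar (flow M0 Phat)]).
Proof.
have [B1 B1E plays] := hfp; have [f_mon g_mon] := h3; have [f_lip g_lip] := h4.
have kc := kappa_continuous hM0 h1; have km := kappa_unique_minimizers hM0 h2.
pose P' n := P n.+1; pose B n := Mbar n.+1.
have B_path0 : simplex_paths (B 0%N) by rewrite /B B1E.
have P_best n : is_argmin (@kernels R S N) (J M0 K f g (B n)) (P' n).
  by have [] := plays n.+1 isT.
have M_flow n : M n.+2 = flow M0 (P' n) by have [] := plays n.+1 isT.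
have B_step n k x :
    n.+2%:R * B n.+1 k x = n.+1%:R * B n k x + flow M0 (P' n) k x.
  have [_ mE bE] := plays n.+1 isT; rewrite /B bE mE.
  by have := lt0r_neq0 (ltr0Sn R n.+1); move: (n.+2%:R) => c c0; field.
have B_path n : simplex_paths (B n) by exact: (belief_path hM0 B_path0 P_best).
have [Ms [Ms_path m_lim]] :=
  flow_limit hM0 kc km f_lip g_lip f_mon g_mon B_path0 P_best B_step.
pose Phat := policy K f g Ms.
have fixed : flow M0 Phat = Ms.
  exact: (limit_fixed_point hM0 kc km f_lip g_lip f_mon g_mon B_path0
    P_best B_step Ms_path m_lim).
have Phat_best : is_argmin (@kernels R S N) (J M0 K f g Ms) Phat.
  exact: (policy_argmin f g hM0 km).
have Phat_mfg : mfg_solution M0 K f g Phat by rewrite /mfg_solution fixed.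
have other Q : mfg_solution M0 K f g Q ->
    is_argmin (@kernels R S N) (J M0 K f g Ms) Q.
  by move=> hQ; rewrite -fixed; exact: (equilibrium_response hM0).
have M_cvg : paths_cvg M (flow M0 Phat).
  move=> k x; rewrite fixed; apply: vanish_cvg.
  apply: vanish_shift; apply: vanish_shift.
  by apply: vanishW m_lim => n; rewrite M_flow; exact: coord_dist.
have Mbar_cvg : paths_cvg Mbar (flow M0 Phat).
  move=> k x; rewrite fixed; apply: vanish_cvg; apply: vanish_shift.
  apply: vanishW (belief_limit hM0 kc km f_lip g_lip f_mon g_mon B_path0
    P_best B_step m_lim) => n.
  exact: (coord_dist (B n)).
split=> [uniq|]; exists Phat; split=> //.
- move=> Q /other oQ; have [Z [_ uZ]] := uniq Ms Ms_path.
  by rewrite -(uZ Q oQ) -(uZ Phat Phat_best).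
- move=> x y k; apply: vanish_cvg; apply: vanish_shift.
  apply: (kernel_limit hM0 kc km f_lip g_lip f_mon g_mon B_path0
    P_best B_step Ms_path m_lim) => n.
  have [Z [_ uZ]] := uniq (B n) (B_path n).
  by rewrite -(uZ _ (P_best n)) -(uZ _ (policy_argmin f g hM0 km (B n))).
- move=> Q /other oQ.
  have [e1 e2] := response_policy hM0 kc km f_lip g_lip Ms_path oQ.
  by rewrite e1; split=> // x y k hx; apply: e2; rewrite e1.
- move=> x y k; rewrite fixed => hx; apply: vanish_cvg; apply: vanish_shift.
  exact: (kernel_limit_visited hM0 kc km f_lip g_lip f_mon g_mon B_path0
    P_best B_step Ms_path m_lim).
Qed.
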